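(* Let $p\ge 2$ be an integer and let $\tilde Q_{\mathbb{Z}}$ be a non-deterministic Extended Ergodic CP Distribution on $\mathcal{M}^*\times\Lambda_p^{\mathbb{Z}}$. Then the translation-normalization action $\{t_k^*\}_{k\in\mathbb{Z}}$ of $\mathbb{Z}$ on $\mathcal{M}^*$ is conservative with respect to $\hat\nu\tilde Q_{\mathbb{Z}}$, the pushforward of $\tilde Q_{\mathbb{Z}}$ by the projection $\hat\nu(\nu,\boldsymbol{i})=\nu$.
   Context: All spaces are separable metric spaces with their Borel $\sigma$-algebras. $\mathcal{M}(\mathbb{R})$ is the space of positive Radon measures on $\mathbb{R}$ (including $0$) with the weak topology ($\nu_n\to\nu$ iff $\int f\,d\nu_n\to\int f\,d\nu$ for all $f\in C_c(\mathbb{R})$). For a measurable map $\rho$, $\rho\nu$ denotes the pushforward of $\nu$ by $\rho$. $\mathbb{N}=\{1,2,\ldots\}$. Normalization: for $0\ne\nu\in\mathcal{M}(\mathbb{R})$ put $\psi(\nu)=\min\{n\in\mathbb{N}:\nu[-(n-1),n)>0\}$ and $N\nu=\nu/\nu[-(\psi(\nu)-1),\psi(\nu))$; put $N0=0$. $\mathcal{M}^*=N(\mathcal{M}(\mathbb{R}))$ is the space of normalized measures. Fix an integer $p\ge2$, $\Lambda_p=\{0,\ldots,p-1\}$. For $j\in\Lambda_p$: $[j)_p=[\frac jp,\frac{j+1}p)$ and $\rho_j(x)=px-j$. On $\mathcal{M}^*\times\Lambda_p^{\mathbb{Z}}$, with points $(\nu,\boldsymbol{i})$, $\boldsymbol{i}=(i_n)_{n\in\mathbb{Z}}$,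 let $\hat\nu(\nu,\boldsymbol{i})=\nu$, $\hat i_n(\nu,\boldsymbol{i})=i_n$, and $M_p(\nu,\boldsymbol{i})=(N\rho_{i_1}\nu,\boldsymbol{\sigma}(\boldsymbol{i}))$, where $(\boldsymbol{\sigma}(\boldsymbol{i}))_n=i_{n+1}$. A Borel probability measure $\tilde Q_{\mathbb{Z}}$ on $\mathcal{M}^*\times\Lambda_p^{\mathbb{Z}}$ is adapted if for every $j\in\Lambda_p$ and almost every $(\nu,\boldsymbol{i})$, $\mathbb{P}_{\tilde Q_{\mathbb{Z}}}(\hat i_1=j\mid\hat\nu,(\hat i_n)_{n\le0})(\nu,\boldsymbol{i})=\nu[j)_p$. It is an Extended Ergodic CP Distribution (Extended ECPD) if it is adapted and is invariant and ergodic under $M_p$. It is deterministic if for almost every $(\nu,\boldsymbol{i})$, $\mathbb{P}_{\tilde Q_{\mathbb{Z}}}(\hat i_1=i_1\mid\hat\nu,(\hat i_n)_{n\le0})(\nu,\boldsymbol{i})=1$, and non-deterministic otherwise. Translations: $t_x(y)=y-x$ on $\mathbb{R}$, $t_x\nu$ is the pushforward, $t_x^*\nu=Nt_x\nu$; these maps define an action on $\mathcal{M}^*$. Conservativity: an action of a group $G$ by measurable maps on a Borel probability space $(\Omega,\mathcal{B},\mu)$ is conservative with respect to $\mu$ if for every $A\in\mathcal{B}$ with $\mu(A)>0$ there is $g\in G\setminus\{1_G\}$ with $\mu(A\cap gA)>0$. *)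

(* Defs.v *)
From HB Require Import structures.
From mathcomp Require Import all_boot all_order all_algebra.
From mathcomp Require Import all_classical all_reals all_analysis.
From mathcomp Require Import measurable_realfun.

Set Implicit Arguments.
Unset Strict Implicit.
Unset Printing Implicit Defensive.

Import Order.TTheory GRing.Theory Num.Theory.
Import numFieldTopology.Exports numFieldNormedType.Exports.

Local Open Scope classical_set_scope.
Local Open Scope ring_scope.

Notation borel T := (g_sigma_algebraType (@open T)).

Lemma continuous_borel_measurable (S T : ptopologicalType) (f : S -> T) :
  continuous f -> measurable_fun [set: borel S] (f : borel S -> borel T).
Proof.
move=> /continuousP cf.
apply: (@measurability _ _ (borel S) (borel T) setT f (@open T)) => //.
move=> _ [B oB <-]; rewrite setTI.
by apply: sub_sigma_algebra; exact: cf.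
Qed.

Section radon_measures.
Context {R : realType}.
Implicit Types f : R -> R.

Definition finite_on_compacts (nu : set R -> \bar R) :=
  forall K : set R, compact K -> (nu K < +oo)%E.

(* A library measure is a function on all subsets, with unspecified values on
   the non-measurable ones. Imposing the value 0 there makes equality in
   [radon] the equality of measures. On the real line, a Borel measure that is
   finite on compact sets is automatically regular. *)
Definition radon : Type :=
  {nu : {measure set R -> \bar R} |
    finite_on_compacts nu /\ forall A, ~ measurable A -> nu A = 0%E}.

Definition radon_measure (nu : radon) : {measure set R -> \bar R} := sval nu.
Coercion radon_measure : radon >-> Measure.type.

HB.instance Definition _ := gen_eqMixin radon.
HB.instance Definition _ := gen_choiceMixin radon.

Definition Cc : set (R -> R) :=
  [set f | continuous f /\ compact (closure (f @^-1` [set~ 0]))].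

Definition Cc_integral (nu : radon) : {ptws Cc -> R} :=
  fun g => (\int[nu]_x set_val g x)%R.

HB.instance Definition _ :=
  Topological.copy radon (initial_topology Cc_integral).

Section erase.
Variable mu : {measure set R -> \bar R}.

Definition erase_nonmeasurable (A : set R) : \bar R :=
  if `[< measurable A >] then mu A else 0%E.

Let erase0 : erase_nonmeasurable set0 = 0%E.
Proof. by rewrite /erase_nonmeasurable measure0 if_same. Qed.

Let erase_ge0 A : (0 <= erase_nonmeasurable A)%E.
Proof. by rewrite /erase_nonmeasurable; case: ifP. Qed.

Let erase_sigma_additive : semi_sigma_additive erase_nonmeasurable.
Proof.
move=> F mF tF mUF; rewrite /erase_nonmeasurable (asboolT mUF).
under eq_fun do under eq_bigr do rewrite (asboolT (mF _)).
exact: measure_semi_sigma_additive.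
Qed.

HB.instance Definition _ := isMeasure.Build _ _ _ erase_nonmeasurable
  erase0 erase_ge0 erase_sigma_additive.

Lemma erase_radon : finite_on_compacts mu ->
  finite_on_compacts erase_nonmeasurable /\
  forall A, ~ measurable A -> erase_nonmeasurable A = 0%E.
Proof.
move=> mufin; split=> [K cK|A mA]; rewrite /erase_nonmeasurable.
  by case: ifP => // _; exact: mufin.
by rewrite asboolF.
Qed.

Definition mk_radon (mufin : finite_on_compacts mu) : radon :=
  exist _ (erase_nonmeasurable : {measure set R -> \bar R})
    (erase_radon mufin).

End erase.

Lemma mk_radonE (mu : {measure set R -> \bar R}) (h : finite_on_compacts mu)
  (A : set R) : measurable A -> mk_radon h A = mu A.
Proof. by move=> mA; rewrite /= /erase_nonmeasurable asboolT. Qed.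

Section push.
Variables (f : R -> R) (cf : continuous f).
Hypothesis proper_f : forall K : set R, compact K -> compact (f @^-1` K).
Variable nu : radon.

Let mf : measurable_fun [set: R] f. Proof. exact: continuous_measurable_fun. Qed.

Let image_measure : set R -> \bar R := pushforward nu f.

Let image_measure0 : image_measure set0 = 0%E. Proof. exact: measure0. Qed.

Let image_measure_ge0 A : (0 <= image_measure A)%E.
Proof. exact: measure_ge0. Qed.

Let image_measure_sigma_additive : semi_sigma_additive image_measure.
Proof. exact: measure_semi_sigma_additive. Qed.

HB.instance Definition _ := isMeasure.Build _ _ _ image_measure
  image_measure0 image_measure_ge0 image_measure_sigma_additive.

Let image_measure_fin : finite_on_compacts image_measure.
Proof. by move=> K cK; apply: (svalP nu).1; exact: proper_f. Qed.

Definition push : radon := mk_radon image_measure_fin.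

End push.

Lemma pushE f (cf : continuous f)
    (pf : forall K : set R, compact K -> compact (f @^-1` K)) (nu : radon)
    (A : set R) :
  measurable A -> push cf pf nu A = nu (f @^-1` A).
Proof. exact: mk_radonE. Qed.

Lemma inverse_proper (f g : R -> R) : continuous g -> cancel f g ->
  cancel g f -> forall K : set R, compact K -> compact (f @^-1` K).
Proof.
move=> cg fK gK K cK; suff -> : f @^-1` K = g @` K.
  by apply: continuous_compact => //; exact: continuous_subspaceT.
apply/seteqP; split=> [x Kfx|_ [y Ky <-]]; first by exists (f x).
by rewrite /preimage/= gK.
Qed.

Definition window (n : nat) : set R := `[- (n%:R - 1), n%:R[.

(* For [nu = 0] no window is charged and [psi nu] is the default 1. *)
Definition psi (nu : radon) : nat :=
  xget 1%N [set n | (0 < n)%N /\ (0 < nu (window n))%E /\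
    forall m, (0 < m)%N -> (0 < nu (window m))%E -> (n <= m)%N].

Section normalize.
Variable nu : radon.

(* For [nu = 0] the factor is 0^-1 = 0, in accordance with N0 = 0. *)
Definition normalizing_factor : R := (fine (nu (window (psi nu))))^-1.

Let factor_ge0 : 0 <= normalizing_factor.
Proof. by rewrite invr_ge0 fine_ge0. Qed.

Let scaled : {measure set R -> \bar R} := mscale (NngNum factor_ge0) nu.

Let scaled_fin : finite_on_compacts scaled.
Proof.
move=> K cK; rewrite /= /mscale/= lte_mul_pinfty//.
exact: (svalP nu).1.
Qed.

Definition normalize : radon := mk_radon scaled_fin.

End normalize.

Lemma normalizeE (nu : radon) (A : set R) : measurable A ->
  normalize nu A = ((normalizing_factor nu)%:E * nu A)%E.
Proof. exact: mk_radonE. Qed.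

Definition normalized : Type := range normalize.

HB.instance Definition _ := Topological.copy normalized (range normalize).

Definition normalized_radon (nu : normalized) : radon := set_val nu.
Coercion normalized_radon : normalized >-> radon.

Definition toNormalized (nu : radon) : normalized :=
  exist _ (normalize nu) (mem_set (imageT normalize nu)).

Let mzero_fin : finite_on_compacts (@mzero _ R R).
Proof. by move=> K _; rewrite /mzero ltry. Qed.

HB.instance Definition _ :=
  isPointed.Build normalized (toNormalized (mk_radon mzero_fin)).

Section translation.
Variable x : R.

Definition translation (y : R) : R := y - x.

Lemma translation_continuous : continuous translation.
Proof. by move=> y; apply: cvgB; [exact: cvg_id|exact: cvg_cst]. Qed.

Lemma translation_proper (K : set R) :
  compact K -> compact (translation @^-1` K).
Proof.
apply: (@inverse_proper _ (fun y => y + x)) => [y|y|y].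
- by apply: cvgD; [exact: cvg_id|exact: cvg_cst].
- exact: subrK.
- exact: addrK.
Qed.

Definition tstar (nu : normalized) : normalized :=
  toNormalized (push translation_continuous translation_proper nu).

End translation.

End radon_measures.
Arguments radon R : clear implicits.
Arguments normalized R : clear implicits.

(* {0, ..., p - 1}; the bound on p makes the type pointed, as the library
   requires of a measurable space. *)
Definition digit (p : nat) (p_gt1 : (1 < p)%N) : Type := 'I_p.

HB.instance Definition _ p p_gt1 := Finite.on (@digit p p_gt1).
HB.instance Definition _ p p_gt1 :=
  isPointed.Build (@digit p p_gt1) (Ordinal (ltnW p_gt1)).

Section extended_CP.
Context (R : realType) (p : nat) (p_gt1 : (1 < p)%N).
Local Notation digit := (digit p_gt1).

Section magnification.
Variable j : digit.

Definition digit_cell : set R := `[(j : nat)%:R / p%:R, (j : nat).+1%:R / p%:R[.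

Definition rho (x : R) : R := p%:R * x - (j : nat)%:R.

Lemma rho_continuous : continuous rho.
Proof.
by move=> x; apply: cvgB; [apply: cvgM => //; exact: cvg_cst|exact: cvg_cst].
Qed.

Lemma rho_proper (K : set R) : compact K -> compact (rho @^-1` K).
Proof.
have p0 : p%:R != 0 :> R by rewrite pnatr_eq0 -lt0n ltnW.
apply: (@inverse_proper _ _ (fun y => p%:R^-1 * (y + (j : nat)%:R))) => [y|y|y].
- apply: cvgM; first exact: cvg_cst.
  by apply: cvgD; [exact: cvg_id|exact: cvg_cst].
- by rewrite /rho subrK mulKf.
- by rewrite /rho mulVKf// addrK.
Qed.

End magnification.

Definition CP_space : Type :=
  (normalized R * {ptws int -> discrete_topology digit})%type.

HB.instance Definition _ := Topological.copy CP_space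
  (normalized R * {ptws int -> discrete_topology digit})%type.
HB.instance Definition _ :=
  isPointed.Build CP_space (point, fun=> point).

Definition nuhat (w : borel CP_space) : borel (normalized R) := w.1.
Definition ihat (n : int) (w : borel CP_space) : digit := w.2 n.

Lemma measurable_nuhat : measurable_fun setT nuhat.
Proof. by apply: continuous_borel_measurable => w; exact: cvg_fst. Qed.

HB.instance Definition _ := isMeasurableFun.Build _ _ _ _ nuhat measurable_nuhat.

Definition M_map (w : borel CP_space) : borel CP_space :=
  (toNormalized (push (@rho_continuous (ihat 1 w)) (@rho_proper (ihat 1 w))
     (w.1 : normalized R)),
   fun n => w.2 (n + 1)).

Definition past : set (set (borel CP_space)) :=
  <<s [set A | (exists2 B, measurable B & A = nuhat @^-1` B) \/
               (exists n j, (n <= 0)%R /\ A = ihat n @^-1` [set j])] >>.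

End extended_CP.
Arguments M_map {R p p_gt1}.
Arguments nuhat {R p p_gt1}.
Arguments past {R p p_gt1}.

Section conditional_probability.
Context d (T : measurableType d) (R : realType) (Q : probability T R).

(* [g] is a version of the conditional probability of [A] given the
   sigma-algebra [G]; versions agree almost everywhere. *)
Definition is_cond_prob (G : set (set T)) (A : set T) (g : T -> \bar R) :=
  [/\ forall B, measurable B -> G (g @^-1` B),
      Q.-integrable setT g &
      forall B, G B -> (\int[Q]_(w in B) g w = Q (A `&` B))%E].

Definition invariant_under (f : T -> T) :=
  forall A, measurable A -> Q (f @^-1` A) = Q A.

Definition ergodic_under (f : T -> T) :=
  forall A, measurable A -> f @^-1` A = A -> Q A = 0%E \/ Q A = 1%E.

(* The group is written additively, so [g != 0] says that [g] is not its
   identity element. *)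
Definition conservative (G : zmodType) (act : G -> T -> T) :=
  forall A, measurable A -> (0 < Q A)%E ->
    exists2 g : G, g != 0 & (0 < Q (A `&` act g @` A))%E.

End conditional_probability.

Section extended_ECPD.
Context (R : realType) (p : nat) (p_gt1 : (1 < p)%N).
Variable Q : probability (borel (CP_space R p_gt1)) R.

Definition adapted := forall j : digit p_gt1,
  exists2 g, is_cond_prob Q past (ihat 1 @^-1` [set j]) g &
    {ae Q, forall w, g w = (nuhat w : normalized R) (digit_cell j)}.

Definition is_extended_ECPD :=
  [/\ adapted, invariant_under Q M_map & ergodic_under Q M_map].

Definition deterministic := exists2 g : digit p_gt1 -> _ -> \bar R,
  (forall j, is_cond_prob Q past (ihat 1 @^-1` [set j]) (g j)) &
  {ae Q, forall w, g (ihat 1 w) w = 1%E}.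

End extended_ECPD.

(* Main.v *)
Require Import Defs.
From mathcomp Require Import all_boot all_order all_algebra.
From mathcomp Require Import all_classical all_reals all_analysis.
From mathcomp Require Import measurable_realfun.
From mathcomp Require Import ring lra zify.

Set Implicit Arguments.
Unset Strict Implicit.
Unset Printing Implicit Defensive.

Import Order.TTheory GRing.Theory Num.Theory.
Import numFieldTopology.Exports numFieldNormedType.Exports.

Local Open Scope classical_set_scope.
Local Open Scope ring_scope.

(** The theorem holds because a wandering set would let the digits be guessed
    from the measure, whereas non-determinism makes every guess fail in the
    long run.

    Let [P] be the law of [nu] and suppose that [A] is wandering: no
    translate [tstar k nu] with [k <> 0] of a point [nu] of [A] lies in [A].
    Magnifying a cell of level [n] of [nu] and normalizing gives a measure
    [magnify n a nu]; for distinct cells these measures are integer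
    translates of each other ([tstar_magnify]), so for each [nu] at most one
    cell [a] has its magnification in [A].  The measure component of the
    [n]-th iterate of [M_map] is the magnification of the cell [code n]
    spelled by the first [n] digits, and by invariance it lies in [A] with
    probability [P A].  Adaptedness says that, given [nu], the code is [a]
    with probability [mass n a nu], the mass of that cell ([mass_chain]).
    Hence, up to the event that the cell met by the code has mass at least
    [e], being in [A] forces the code to be the one cell permitted by [nu],
    of mass less than [e], and this has probability at most [e]: that is
    [wandering_bound].

    It remains to see that the mass of the cell met by the code tends to 0
    ([code_mass_small]).  Its limit [atom_mass] does not decrease along
    orbits, since [M_map] divides cell masses by the mass of the first cell;
    by invariance of [Q] it is then almost surely constant along orbits
    ([nondecreasing_along_orbits_ae]).  By ergodicity it is positive almost
    surely or null almost surely ([ergodic_subinvariant]).  In the first case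
    the first cell has mass 1 almost surely, which is determinism.

    Finally, from an arbitrary [A] of positive measure that never meets its
    translates in positive measure, removing all its nontrivial translates
    leaves a wandering set of the same measure.

    Two points support this argument.  First, normalization is not
    continuous, so that Borel measurability of [M_map] and [tstar] needs
    care: it is obtained by refining the topology with the normalizing
    factor, a measurable real function ([refined_measurable]).  Second, all
    manipulations of normalized images reduce to the fact that proportional
    measures have the same normalization ([proportional_normalize]). *)

(** * Radon measures up to a positive factor *)

Section radon_theory.
Context {R : realType}.
Implicit Types (nu mu : radon R) (A : set R).

(** The values on non-measurable sets being fixed, agreement on Borel sets is
    Leibniz equality; every identity between Radon measures below goes through
    this. *)
Lemma radon_ext nu mu :
  (forall A, measurable A -> nu A = mu A) -> nu = mu.
Proof.
case: nu mu => [nu [nufin nu0]] [mu [mufin mu0]]/= numu.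
apply: eq_exist => /=; apply/eq_measure/funext => A.
have [mA|mA] := pselect (measurable A); first exact: numu.
by rewrite nu0// mu0.
Qed.

Lemma radon_itv_fin nu (a b : R) : (nu `[a, b[%classic < +oo)%E.
Proof.
apply: (@le_lt_trans _ _ (nu `[a, b]%classic)); last first.
  by apply: (svalP nu).1; exact: segment_compact.
by apply: le_measure; rewrite ?inE//; apply: subset_itvl; rewrite bnd_simp.
Qed.

Lemma measurable_window n : measurable (window n : set R).
Proof. exact: measurable_itv. Qed.
Hint Resolve measurable_window : core.

(** The zero measure is proportional to itself only, in accordance with the
    convention that it is its own normalization, so that [proportional] relates every
    measure to its normalization. *)
Definition proportional nu mu :=
  exists2 c : R, 0 < c & forall A, measurable A -> mu A = (c%:E * nu A)%E.

(** The windows exhaust the line, so that a nonzero measure has a well-defined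
    first charged window. *)
Lemma window_charged nu (A : set R) : measurable A -> nu A != 0%E ->
  exists n, (0 < n)%N /\ (0 < nu (window n))%E.
Proof.
move=> mA nuA; apply: contrapT => /forallNP nowin.
have win0 n : nu (window n.+1) = 0%E.
  apply/eqP; rewrite eq_le measure_ge0 andbT leNgt; apply/negP => h.
  by apply: (nowin n.+1).
have nuT : nu setT = 0%E.
  have -> : [set: R] = \bigcup_n window n.+1.
    apply/esym/seteqP; split=> // x _.
    have [n _ hn] := nbhs_infty_gtr `|x|.
    exists n => //; rewrite /window /= in_itv/= -natr1 addrK.
    have := hn n (leqnn n); rewrite ltr_norml => /andP[h1 h2].
    by rewrite ltW//= (lt_trans h2)// ltrDl.
  apply/negligibleP; first by apply: bigcup_measurable => k _; exact: measurable_itv.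
  by apply: negligible_bigcup => n; apply/negligibleP; [exact: measurable_itv|exact: win0].
move/eqP: nuA; apply; apply/eqP; rewrite eq_le measure_ge0 andbT -nuT.
by apply: le_measure; rewrite ?inE.
Qed.

Lemma psiP nu A : measurable A -> nu A != 0%E ->
  (0 < psi nu)%N /\ (0 < nu (window (psi nu)))%E /\
  forall m, (0 < m)%N -> (0 < nu (window m))%E -> (psi nu <= m)%N.
Proof.
move=> mA nuA.
have [k hk] := window_charged mA nuA.
have ex : exists n, `[< (0 < n)%N /\ (0 < nu (window n))%E >].
  by exists k; apply/asboolP.
case: (ex_minnP ex) => n /asboolP[n0 nun] nmin.
rewrite /psi; case: xgetP => [m -> //|/(_ n)[]].
by split=> //; split=> // m m0 num; apply: nmin; apply/asboolP.
Qed.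

Lemma psi_window1 nu : nu (window 1) != 0%E -> psi nu = 1%N.
Proof.
move=> nu1; have nu1_gt0 : (0 < nu (window 1))%E by rewrite lt_neqAle eq_sym nu1/=.
have [psi0 [_ psimin]] := psiP (measurable_itv _) nu1.
by apply/eqP; rewrite eqn_leq psi0 andbT psimin.
Qed.

Lemma normalize_proportional nu : proportional nu (normalize nu).
Proof.
have [[A mA nuA]|nu0] :=
  pselect (exists2 A, measurable A & nu A != 0%E).
  have [_ [w0 _]] := psiP mA nuA.
  exists (normalizing_factor nu); last by move=> B; exact: normalizeE.
  rewrite invr_gt0 fine_gt0// w0/=; exact: radon_itv_fin.
exists 1 => // B mB; rewrite normalizeE// mul1e.
suff -> : nu B = 0%E by rewrite mule0.
by apply/eqP; apply: contrapT => nuB; apply: nu0; exists B => //; apply/negP.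
Qed.

(** Proportional measures charge the same windows, so they share their first
    charged window, and the factor cancels in the division. *)
Lemma proportional_normalize nu mu :
  proportional nu mu -> normalize nu = normalize mu.
Proof.
move=> [c c0 munu].
have psiE : psi mu = psi nu.
  rewrite /psi; congr (xget _ _); apply/funext => n; apply/propext.
  have e m : (0 < mu (window m))%E = (0 < nu (window m))%E.
    by rewrite munu// pmule_rgt0.
  by rewrite /= e; split=> -[? [? h]]; split=> //; split=> // m; move: (h m);
     rewrite e.
apply: radon_ext => A mA; rewrite !normalizeE// /normalizing_factor psiE.
rewrite !munu// fineM//; last by rewrite ge0_fin_numE// radon_itv_fin.
rewrite invfM muleA; congr (_ * _)%E; rewrite /= -EFinM mulrAC mulVf ?mul1r//.
by rewrite gt_eqF.
Qed.

Lemma normalize_idem nu : normalize (normalize nu) = normalize nu.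
Proof. by apply/esym/proportional_normalize/normalize_proportional. Qed.

Lemma normalized_eq (nu mu : normalized R) :
  (nu : radon R) = (mu : radon R) -> nu = mu.
Proof. exact: val_inj. Qed.

Lemma toNormalizedK (nu : normalized R) : toNormalized nu = nu.
Proof.
apply: normalized_eq; case: nu => nu nuP /=; rewrite /normalized_radon/= set_valE/=.
by have [mu _ <-] := set_mem nuP; exact: normalize_idem.
Qed.

(** A normalized measure gives [0, 1) mass 1 or 0, according to whether the
    first window is charged. *)
Lemma normalized_unit_le1 (nu : normalized R) : ((nu : radon R) `[0%R, 1%R[%classic <= 1)%E.
Proof.
have [mu _ ->] : exists2 mu, True & (nu : radon R) = normalize mu.
  by have [mu _ e] := set_mem (valP nu); exists mu => //; exact: esym.
have win1 : `[0, 1[%classic = window 1 :> set R by rewrite /window subrr oppr0.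
rewrite win1 normalizeE//.
have [->|mu1] := eqVneq (mu (window 1)) 0%E; first by rewrite mule0.
rewrite /normalizing_factor psi_window1//.
have fin1 : mu (window 1) \is a fin_num by rewrite ge0_fin_numE// radon_itv_fin.
rewrite -[X in (_ * X)%E]fineK// -EFinM mulVf//.
by rewrite fine_eq0.
Qed.

End radon_theory.

Section normalized_push.
Context {R : realType}.
Implicit Types (nu mu : radon R) (A : set R).

Section comp.
Variables (f g h : R -> R).
Variables (cf : continuous f) (cg : continuous g) (ch : continuous h).
Hypothesis pf : forall K : set R, compact K -> compact (f @^-1` K).
Hypothesis pg : forall K : set R, compact K -> compact (g @^-1` K).
Hypothesis ph : forall K : set R, compact K -> compact (h @^-1` K).
Hypothesis fg : forall y, f (g y) = h y.

Lemma push_comp nu : push cf pf (push cg pg nu) = push ch ph nu.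
Proof.
have mfA A : measurable A -> measurable (f @^-1` A).
  move=> mA; rewrite -[X in measurable X]setTI.
  exact: (continuous_measurable_fun cf).
apply: radon_ext => A mA; rewrite !pushE//; last exact: mfA.
rewrite (_ : h @^-1` A = g @^-1` (f @^-1` A))//.
by apply/funext => y; rewrite /preimage/= fg.
Qed.

Lemma push_proportional nu mu :
  proportional nu mu -> proportional (push cf pf nu) (push cf pf mu).
Proof.
have mfA A : measurable A -> measurable (f @^-1` A).
  move=> mA; rewrite -[X in measurable X]setTI.
  exact: (continuous_measurable_fun cf).
move=> [c c0 munu]; exists c => // A mA.
by rewrite !pushE// munu//; exact: mfA.
Qed.

(** An inner normalization only multiplies the measure by a positive factor,
    which the outer normalization removes. This is the source of every
    composition law for magnifications and translations. *)
Lemma normalized_push_comp nu :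
  toNormalized (push cf pf (toNormalized (push cg pg nu))) =
  toNormalized (push ch ph nu).
Proof.
apply: normalized_eq; apply/esym; rewrite -push_comp.
exact/proportional_normalize/push_proportional/normalize_proportional.
Qed.

End comp.

Lemma push_eq (f g : R -> R) (cf : continuous f) (cg : continuous g)
    (pf : forall K : set R, compact K -> compact (f @^-1` K))
    (pg : forall K : set R, compact K -> compact (g @^-1` K)) nu :
  f = g -> push cf pf nu = push cg pg nu.
Proof.
by move=> fg; apply: radon_ext => A mA; rewrite !pushE// fg.
Qed.

End normalized_push.

Section blowup.
Context {R : realType}.
Implicit Types (nu : normalized R) (A : set R) (s b : R).

Definition affine s b (y : R) : R := s * y - b.

Lemma affine_continuous s b : continuous (affine s b).
Proof.
by move=> y; apply: cvgB; [apply: cvgM => //; exact: cvg_cst|exact: cvg_cst].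
Qed.

Lemma measurable_affine s b : measurable_fun setT (affine s b).
Proof. by apply: continuous_measurable_fun; exact: affine_continuous. Qed.

Lemma affine_proper s b : 0 < s -> forall K : set R, compact K ->
  compact (affine s b @^-1` K).
Proof.
move=> s0; have s_neq0 : s != 0 by rewrite gt_eqF.
apply: (@inverse_proper _ _ (fun y => s^-1 * (y + b))) => [y|y|y].
- apply: cvgM; first exact: cvg_cst.
  by apply: cvgD; [exact: cvg_id|exact: cvg_cst].
- by rewrite /affine subrK mulKf.
- by rewrite /affine mulVKf// addrK.
Qed.

Definition blowup s b (s0 : 0 < s) nu : normalized R :=
  toNormalized (push (@affine_continuous s b) (@affine_proper s b s0) nu).

(** The parameters of the composite are constrained by equations instead of
    being substituted, so that the rule applies to scales given in any form. *)
Lemma blowup_comp s b s' b' s'' b'' (s0 : 0 < s) (s'0 : 0 < s') (s''0 : 0 < s'')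
    nu : s * s' = s'' -> s * b' + b = b'' ->
  blowup b s0 (blowup b' s'0 nu) = blowup b'' s''0 nu.
Proof.
move=> es eb; apply: normalized_push_comp => y.
by rewrite /affine -es -eb mulrBr opprD addrA mulrA.
Qed.

Lemma blowup_id s b (s0 : 0 < s) nu : s = 1 -> b = 0 -> blowup b s0 nu = nu.
Proof.
move=> s1 b0.
rewrite -[RHS]toNormalizedK; congr (toNormalized _); apply: radon_ext => A mA.
rewrite pushE//; congr (_ _); apply/seteqP.
by split=> y /=; rewrite /affine s1 b0 mul1r subr0.
Qed.

Lemma tstar_blowup x (s0 : 0 < 1) nu : tstar x nu = blowup x s0 nu.
Proof.
congr (toNormalized _); apply: push_eq; apply/funext => y.
by rewrite /affine mul1r.
Qed.

Lemma tstarD x y nu : tstar x (tstar y nu) = tstar (x + y) nu.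
Proof.
rewrite !(tstar_blowup _ ltr01); apply: blowup_comp; first exact: mulr1.
by rewrite mul1r addrC.
Qed.

Lemma tstar0 nu : tstar 0 nu = nu.
Proof. by rewrite (tstar_blowup _ ltr01) blowup_id. Qed.

Definition unit_cell s b : set R := affine s b @^-1` `[0, 1[.

Lemma unit_cellE s b : 0 < s -> unit_cell s b = `[b / s, (b + 1) / s[%classic.
Proof.
move=> s0; apply/seteqP; split=> y; rewrite /unit_cell /affine/= !in_itv/=;
  by rewrite ler_pdivrMr// ltr_pdivlMr// subr_ge0 ltrBlDl mulrC.
Qed.

(** Inside [0, 1), a magnified measure is a conditional measure: the
    normalization divides by the mass of the magnified cell. *)
Lemma blowup_cond s b (s0 : 0 < s) nu A : measurable A -> A `<=` `[0, 1[ ->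
  ((blowup b s0 nu : radon R) A * (nu : radon R) (unit_cell s b) =
   (nu : radon R) (affine s b @^-1` A))%E.
Proof.
move=> mA A01; set mu := push (@affine_continuous s b) (@affine_proper s b s0) nu.
have win1 : `[0, 1[%classic = window 1 :> set R by rewrite /window subrr oppr0.
have -> : (nu : radon R) (unit_cell s b) = mu (window 1).
  by rewrite pushE// -win1.
have <- : mu A = (nu : radon R) (affine s b @^-1` A) by rewrite pushE.
rewrite [X in (X * _)%E](_ : _ = normalize mu A)// normalizeE//.
have [mu1|mu1] := eqVneq (mu (window 1)) 0%E.
  rewrite mu1 mule0; apply/esym/eqP; rewrite eq_le measure_ge0 andbT -mu1.
  by apply: le_measure; rewrite ?inE// -win1.
rewrite /normalizing_factor psi_window1//.
have fin1 : mu (window 1) \is a fin_num by rewrite ge0_fin_numE// radon_itv_fin.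
rewrite muleAC -[X in (_ * X * _)%E]fineK// -EFinM mulVf ?mul1e//.
by rewrite fine_eq0.
Qed.

End blowup.

(** * Borel measurability of normalization *)

Section tent.
Context {R : realType}.
Variables (a b : R).

(** Trapezoids converging pointwise to the indicator of [a, b). *)
Definition tent (n : nat) (y : R) : R :=
  Num.max 0 (Num.min 1 (Num.min (n.+1%:R * (y - a) + 1) (n.+1%:R * (b - y)))).

Lemma tent_continuous n : continuous (tent n).
Proof.
move=> y; rewrite (_ : tent n = cst 0 \max (cst 1 \min
  ((fun z => n.+1%:R * (z - a) + 1) \min (fun z => n.+1%:R * (b - z)))))//.
apply: (@continuous_max R); first exact: cvg_cst.
apply: (@continuous_min R); first exact: cvg_cst.
apply: (@continuous_min R).
  apply: cvgD; last exact: cvg_cst.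
  by apply: cvgM; [exact: cvg_cst|apply: cvgB; [exact: cvg_id|exact: cvg_cst]].
by apply: cvgM; [exact: cvg_cst|apply: cvgB; [exact: cvg_cst|exact: cvg_id]].
Qed.

Lemma tent_ge0 n y : 0 <= tent n y.
Proof. by rewrite /tent le_max lexx. Qed.

Lemma tent_le1 n y : tent n y <= 1.
Proof. by rewrite /tent ge_max ler01 ge_min lexx. Qed.

Lemma tent_out n y : y \notin `[a - 1, b] -> tent n y = 0.
Proof.
rewrite in_itv/= negb_and -!ltNge => /orP[ya|yb]; apply/max_idPl;
  rewrite !ge_min; apply/orP; right; apply/orP; [left|right].
- have : (y - a + 1) * n.+1%:R <= y - a + 1.
    rewrite ler_neMr// ?ler1n//; last by lra.
  have : 0 <= n%:R :> R by [].
  rewrite -natr1; nra.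
- by rewrite pmulr_rle0// subr_le0 ltW.
Qed.

Lemma tent_Cc n : Cc (tent n).
Proof.
split; first exact: tent_continuous.
apply: (@subclosed_compact _ _ `[a - 1, b]); first exact: closed_closure.
  exact: segment_compact.
have /closure_id -> : closed `[a - 1, b]%classic by exact: itv_closed.
apply: closure_subset => y /= /eqP; apply: contra_neqT => /tent_out; exact.
Qed.

Lemma tent_cvg y : tent n y @[n --> \oo] --> (\1_`[a, b[%classic y : R).
Proof.
apply: cvg_near_cst; rewrite indicE mem_setE in_itv/=.
have [ya|ay] := ltP y a; have [yb|yb] := ltP y b => /=.
- near=> n; apply/max_idPl; rewrite !ge_min; apply/orP; right.
  apply/orP; left; have : (a - y)^-1 < n.+1%:R.
    by rewrite -natr1 ltr_wpDr//; near: n; exact: nbhs_infty_gtr.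
  by rewrite invf_plt ?posrE ?subr_gt0// -[_^-1]mul1r ltr_pdivrMr//; lra.
- near=> n; apply/max_idPl; rewrite !ge_min; apply/orP; right.
  apply/orP; right; by rewrite pmulr_rle0// subr_le0.
- near=> n; have h : (b - y)^-1 < n.+1%:R.
    by rewrite -natr1 ltr_wpDr//; near: n; exact: nbhs_infty_gtr.
  rewrite /tent min_l ?max_r//; rewrite le_min; apply/andP; split.
    by rewrite lerDr mulr_ge0// subr_ge0.
  by move: h; rewrite -[_^-1]mul1r ltr_pdivrMr ?subr_gt0// => /ltW.
- near=> n; apply/max_idPl; rewrite !ge_min; apply/orP; right.
  apply/orP; right; by rewrite pmulr_rle0// subr_le0.
Unshelve. all: by end_near. Qed.

End tent.

Section measurability.
Context {R : realType}.

Lemma continuous_measurable_real (X : ptopologicalType) (f : X -> R) :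
  continuous f -> measurable_fun setT (f : borel X -> R).
Proof.
move=> /continuousP cf.
apply: (measurability _ (RGenOpens.measurableE R)) => _ [_ [x [y ->]] <-].
rewrite setTI; apply: sub_sigma_algebra; apply: cf.
exact: interval_open.
Qed.

(** The index type is arbitrary because the topology of Radon measures is
    indexed by test functions. *)
Lemma continuous_pointwise (X : topologicalType) (I : Type)
    (T : I -> topologicalType) (f : X -> prod_topology T) :
  (forall i, continuous (fun x => f x i)) -> continuous f.
Proof.
move=> cf x; apply/cvg_sup => i; move: x.
apply/(@continuousP _ (initial_topology (@^~ i))) => A [B oB <-].
by move/continuousP : (cf i); exact.
Qed.

Lemma continuous_coordinate (I : Type) (T : I -> topologicalType) (i : I) :
  continuous (fun f : prod_topology T => f i).
Proof.
move=> f; have /cvg_sup/(_ i) ff : f --> f by exact: cvg_id.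
move=> A /(@initial_continuous _ _ (fun f : prod_topology T => f i)).
exact: ff.
Qed.

Lemma Cc_integral_continuous (X : topologicalType) (F : X -> radon R)
  (g : R -> R) : continuous F -> Cc g ->
  continuous (fun x => \int[F x]_y g y).
Proof.
move=> cF Cg x.
have cI : {for x, continuous (Cc_integral \o F)}.
  exact: continuous_comp (cF x) (@initial_continuous _ _ Cc_integral (F x)).
exact: (@continuous_comp _ _ _ (Cc_integral \o F)
  (fun h : {ptws Cc -> R} => h (exist _ g (mem_set Cg))) x cI
  (@continuous_coordinate _ (fun=> R) _ _)).
Qed.

Lemma tent_integral_cvg (a b : R) (nu : radon R) :
  (\int[nu]_y tent a b n y)%:E @[n --> \oo] --> nu `[a, b[%classic.
Proof.
have mtent n : measurable_fun setT (EFin \o tent a b n).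
  apply/measurable_EFinP; apply: continuous_measurable_fun.
  exact: tent_continuous.
have le1 n y : (`|(tent a b n y)%:E| <= (\1_`[a - 1%R, b]%classic y)%:E)%E.
  rewrite gee0_abs ?lee_fin ?tent_ge0// indicE mem_setE.
  have [_|yout] := boolP (y \in `[a - 1, b]); first exact: tent_le1.
  by rewrite tent_out.
have int1 : nu.-integrable setT (fun y => (\1_`[a - 1%R, b]%classic y)%:E).
  apply/integrableP; split; first exact/measurable_EFinP.
  under eq_integral do rewrite gee0_abs ?lee_fin//.
  rewrite integral_indic// setIT.
  by apply: (svalP nu).1; exact: segment_compact.
have mind : measurable_fun setT (fun y => (\1_`[a, b[%classic y)%:E : \bar R).
  exact/measurable_EFinP.
have tcvg : {ae nu, forall y, [set: R] y ->
    (EFin \o tent a b n) y @[n --> \oo] --> (\1_`[a, b[%classic y)%:E}.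
  by apply: aeW => y _; apply: cvg_EFin; [exact: nearW|exact: tent_cvg].
have tle1 : {ae nu, forall y n, [set: R] y ->
    (`|(EFin \o tent a b n) y| <= (\1_`[a - 1%R, b]%classic y)%:E)%E}.
  by apply: aeW => y n _; exact: le1.
have [_ _] := dominated_convergence measurableT mtent mind tcvg int1 tle1.
rewrite integral_indic// setIT.
rewrite (_ : [sequence _]_n = (fun n => (\int[nu]_y tent a b n y)%:E))//.
apply/funext => n; rewrite /Rintegral fineK//.
apply: integrable_fin_num => //.
apply: (le_integrable measurableT (mtent n) _ int1) => y _.
rewrite [leRHS]gee0_abs ?lee_fin//; exact: le1.
Qed.

(** The mass of [a, b) is not continuous in the measure, but it is the limit of
    the integrals of the trapezoids, which are. *)
Lemma measurable_itv_mass (X : ptopologicalType) (F : X -> radon R) (a b : R) :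
  continuous F ->
  measurable_fun setT (fun x : borel X => F x `[a, b[%classic).
Proof.
move=> cF; apply: (emeasurable_fun_cvg (fun n (x : borel X) =>
  (\int[F x]_y tent a b n y)%:E)).
  move=> n; apply/measurable_EFinP; apply: continuous_measurable_real.
  exact: Cc_integral_continuous cF (tent_Cc a b n).
by move=> x _; exact: tent_integral_cvg.
Qed.

Lemma measurable_invr : measurable_fun setT (fun x : R => x^-1).
Proof.
rewrite -(setvU [set 0 : R]); apply/measurable_funU => //.
  exact: measurableC.
split; last exact: measurable_fun_set1.
apply: open_continuous_measurable_fun.
  by rewrite openC; exact: closed_eq.
by move=> x /set_mem/= /eqP x0; exact: inv_continuous.
Qed.

(** The factor is a different measurable function on each of the countably many
    pieces [P n] where the first charged window is the [n]-th, and 0 on the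
    remaining piece, where no window is charged. *)
Lemma measurable_normalizing_factor (X : ptopologicalType) (F : X -> radon R) :
  continuous F ->
  measurable_fun setT (fun x : borel X => normalizing_factor (F x)).
Proof.
move=> cF; have mmass n : measurable_fun setT (fun x : borel X => F x (window n)).
  exact: measurable_itv_mass.
pose W n : set (borel X) := [set x | (0 < n)%N /\ (0 < F x (window n))%E].
have mW n : measurable (W n).
  have [n0|n0] := boolP (0 < n)%N; last first.
    by rewrite (_ : W n = set0)//; apply/seteqP; split=> [x [/(negP n0)]|].
  rewrite (_ : W n = [set: borel X] `&` [set x : borel X | (0 < F x (window n))%E]).
    exact: (emeasurable_fun_o_infty measurableT (mmass n)).
  by apply/seteqP; split => [x []|x []].
pose P n : set (borel X) := W n `\` \bigcup_(m < n) W m.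
have mP n : measurable (P n) by apply: measurableD => //; exact: bigcup_measurable.
have factorP n x : P n x ->
    normalizing_factor (F x) = (fine (F x (window n)))^-1.
  move=> [[n0 xn] nxm]; rewrite /normalizing_factor.
  have [psi0 [psix psimin]] := psiP (measurable_itv _) (negbT (gt_eqF xn)).
  suff -> : psi (F x) = n by [].
  apply/eqP; rewrite eqn_leq psimin//= leqNgt; apply/negP => psin.
  by apply: nxm; exists (psi (F x)).
have factor0 x : ~ (\bigcup_n P n) x -> normalizing_factor (F x) = 0.
  move=> nPx; have nW n : ~ W n x.
    elim/ltn_ind: n => n ih Wn; apply: nPx; exists n => //; split=> // -[m mn].
    exact: ih.
  rewrite /normalizing_factor (_ : F x (window (psi (F x))) = 0)%E ?invr0//.
  apply/eqP; rewrite eq_le measure_ge0 andbT leNgt; apply/negP => h.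
  apply: (nW (psi (F x))); split=> //.
  by have [] := psiP (measurable_itv _) (negbT (gt_eqF h)).
move=> _ B mB; rewrite setTI.
rewrite (_ : _ @^-1` B = (~` (\bigcup_n P n) `&` [set _ | B 0]) `|`
  \bigcup_n (P n `&` (fun x : borel X => (fine (F x (window n)))^-1) @^-1` B)).
  apply: measurableU.
    apply: measurableI; last first.
      have [B0|B0] := pselect (B 0).
        by rewrite (_ : [set _ | _] = setT)//; apply/seteqP; split.
      by rewrite (_ : [set _ | _] = set0)//; apply/seteqP; split.
    by apply: measurableC; exact: bigcup_measurable.
  apply: bigcup_measurable => n _; apply: measurableI => //.
  rewrite -[X in measurable X]setTI.
  suff : measurable_fun setT (fun x : borel X => (fine (F x (window n)))^-1).
    exact.
  apply: (measurableT_comp measurable_invr).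
  exact: (measurableT_comp (fine_measurable measurableT)).
apply/seteqP; split=> x.
  have [Px|nPx] := pselect ((\bigcup_n P n) x); last first.
    by rewrite /preimage/= factor0// => B0; left.
  have [n _ Pn] := Px.
  by rewrite /preimage/= (factorP n)// => Bx; right; exists n.
move=> [[nPx B0]|[n _ [Pn Bx]]]; rewrite /preimage/=.
  by rewrite factor0.
by rewrite (factorP n).
Qed.

(** Refining the topology by one measurable real function [c] does not add Borel
    sets, because only countably many rational intervals [I q] of values of [c]
    are needed: an open set of the refinement is the union over [q] of the
    open set [V q] intersected with the preimage of [I q]. *)
Lemma refined_measurable (X Y : ptopologicalType) (c : X -> R) (G : X -> Y) :
  measurable_fun setT (c : borel X -> R) ->
  continuous (G : initial_topology (fun x => (x, c x)) -> Y) ->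
  measurable_fun setT (G : borel X -> borel Y).
Proof.
move=> mc /continuousP cG.
apply: (@measurability _ _ (borel X) (borel Y) setT G (@open Y)) => //.
move=> _ [B oB <-]; rewrite setTI; have [U oU <-] := cG B oB.
pose I (q : rat * rat) : set R := `]ratr q.1, ratr q.2[%classic.
pose V (q : rat * rat) : set X :=
  \bigcup_(O in [set O : set X | open O /\ O `*` I q `<=` U]) O.
rewrite (_ : _ @^-1` U = \bigcup_q (V q `&` c @^-1` I q)).
  apply: countable_bigcupT_measurable => [|q]; first exact: countableP.
  apply: measurableI.
    by apply: sub_sigma_algebra; apply: bigcup_open => O [].
  rewrite -[X in measurable X]setTI; by apply: mc => //; exact: measurable_itv.
apply/seteqP; split=> x; last first.
  by move=> [q _ [[W [_ WU] Wx] cx]]; apply: WU.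
move=> Ux.
have : nbhs (x, c x) U by apply: open_nbhs_nbhs.
move=> [[A1 A2] [/= A1x A2x] AU].
have [e /= e0 eA2] := (nbhs_ballP _ _).1 A2x.
have [q1] := @rat_in_itvoo R (c x - e) (c x) ltac:(by rewrite ltrBlDr ltrDl).
rewrite in_itv/= => /andP[eq1 q1c].
have [q2] := @rat_in_itvoo R (c x) (c x + e) ltac:(by rewrite ltrDl).
rewrite in_itv/= => /andP[cq2 q2e].
exists (q1, q2) => //; split; last by rewrite /preimage/I/= in_itv/= q1c.
exists A1^°.
  split; first exact: open_interior.
  move=> [y t]/= [/interior_subset A1y]; rewrite /I/= in_itv/= => /andP[q1t tq2].
  apply: AU; split=> //=; apply: eA2; rewrite /ball/= ltr_distlC.
  by rewrite (lt_trans eq1)//= (lt_trans tq2).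
exact: A1x.
Qed.

(** When the integral of [g] is infinite or undefined its real value is 0, and
    so is that of its positive multiples. *)
Lemma Rintegral_normalize (nu : radon R) (g : R -> R) : measurable_fun setT g ->
  \int[normalize nu]_y g y = normalizing_factor nu * \int[nu]_y g y.
Proof.
move=> mg; have mEg : measurable_fun setT (EFin \o g) by exact/measurable_EFinP.
set c := normalizing_factor nu.
have c0 : 0 <= c by rewrite invr_ge0 fine_ge0.
rewrite /Rintegral (@eq_measure_integral _ _ _ _ (mscale (NngNum c0) nu));
  last by move=> A mA _; rewrite normalizeE.
rewrite integralE ge0_integral_mscale//; last exact: measurable_funepos.
rewrite ge0_integral_mscale//; last exact: measurable_funeneg.
set a := (X in (c%:E * X - _)%E); set b := (X in (_ - c%:E * X)%E).
have -> : (\int[nu]_y (g y)%:E = a - b)%E by rewrite integralE.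
have a0 : (0 <= a)%E by exact: integral_ge0.
have b0 : (0 <= b)%E by exact: integral_ge0.
have [->|cn0] := eqVneq c 0; first by rewrite !mul0e mul0r subee.
have {c0 cn0}c0 : 0 < c by rewrite lt_neqAle eq_sym cn0.
case: a a0 => [a| |]//; case: b b0 => [b| |]// _ _.
- by rewrite /= mulrBr.
- by rewrite gt0_muley//= mulr0.
- by rewrite gt0_muley//= mulr0.
- by rewrite gt0_muley//= mulr0.
Qed.

(** The integral of a test function against the normalized measure is the
    product of two functions that are continuous for the refined topology. *)
Lemma continuous_normalize (X : choiceType) (Z : topologicalType) (w : X -> Z)
    (F : X -> radon R) :
  continuous (F : initial_topology w -> radon R) ->
  continuous ((fun x => normalizing_factor (F x)) : initial_topology w -> R) ->
  continuous ((fun x => toNormalized (F x)) : initial_topology w -> normalized R).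
Proof.
move=> cF cc.
apply: continuous_comp_initial; apply: continuous_comp_initial.
apply: continuous_pointwise => -[g Cg] /=.
rewrite (_ : (fun _ => _) =
    (fun x => normalizing_factor (F x) * \int[F x]_y g y)).
  move=> x; apply: (@continuousM _ (initial_topology w)); first exact: cc.
  exact: (Cc_integral_continuous cF (set_mem Cg)).
apply/funext => x; rewrite -Rintegral_normalize//.
exact: continuous_measurable_fun (set_mem Cg).1.
Qed.
End measurability.

(** Formulated for two measures related on measurable sets rather than for a
    pushforward, so as to cover both the images of Radon measures and the
    invariance of a probability. *)
Lemma ge0_integral_image d1 d2 (X : measurableType d1) (Y : measurableType d2)
    (R : realType) (mu : {measure set X -> \bar R})
    (nu : {measure set Y -> \bar R}) (phi : X -> Y) (D : set Y)
    (f : Y -> \bar R) :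
  measurable_fun setT phi ->
  (forall A, measurable A -> nu A = mu (phi @^-1` A)) ->
  measurable D -> measurable_fun D f -> (forall y, 0 <= f y)%E ->
  (\int[nu]_(y in D) f y = \int[mu]_(x in phi @^-1` D) f (phi x))%E.
Proof.
move=> mphi numu mD mf f0.
rewrite -(ge0_integral_pushforward mphi mu mD mf (fun y _ => f0 y)).
(* The image of [mu], a measure because [phi] is measurable. *)
pose image : {measure set Y -> \bar R} :=
  measure_function_pushforward__canonical__measure_function_Measure mu mphi.
exact: (@eq_measure_integral _ _ _ D image nu f (fun A mA _ => numu A mA)).
Qed.

Section push_continuity.
Context {R : realType}.
Variables (f : R -> R) (cf : continuous f).
Hypothesis pf : forall K : set R, compact K -> compact (f @^-1` K).

Lemma Rintegral_push (nu : radon R) (g : R -> R) : measurable_fun setT g ->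
  \int[push cf pf nu]_y g y = \int[nu]_y g (f y).
Proof.
move=> mg; have mf : measurable_fun setT f by exact: continuous_measurable_fun.
have mEg : measurable_fun setT (EFin \o g) by exact/measurable_EFinP.
have image A : measurable A -> push cf pf nu A = nu (f @^-1` A).
  exact: pushE.
rewrite /Rintegral integralE [in RHS]integralE.
rewrite (ge0_integral_image mf image)//; last exact: measurable_funepos.
rewrite (ge0_integral_image mf image)//; last exact: measurable_funeneg.
rewrite preimage_setT; congr (fine (_ - _)%E); apply: eq_integral => y _.
  by rewrite !funeposE.
by rewrite !funenegE.
Qed.

Lemma Cc_comp (g : R -> R) : Cc g -> Cc (g \o f).
Proof.
move=> [cg Kg]; split; first by move=> y; apply: continuous_comp; [exact: cf|exact: cg].
apply: (subclosed_compact _ (pf Kg)); first exact: closed_closure.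
have /closure_id -> : closed (f @^-1` closure (g @^-1` [set~ 0])).
  by apply: closed_comp => [y _|]; [exact: cf|exact: closed_closure].
by apply: closure_subset => y /= gfy; apply: subset_closure.
Qed.

Lemma push_continuous : continuous (push cf pf).
Proof.
apply: continuous_comp_initial; apply: continuous_pointwise => -[g /= gCc].
have Cg := set_mem gCc.
rewrite (_ : (fun _ => _) = (fun nu : radon R => \int[nu]_y (g \o f) y)).
  exact: (@Cc_integral_continuous _ _ id _ (fun=> cvg_id) (Cc_comp Cg)).
apply/funext => nu; apply: Rintegral_push.
exact: continuous_measurable_fun Cg.1.
Qed.

Lemma continuous_push_normalized :
  continuous (fun nu : normalized R => push cf pf nu).
Proof.
move=> nu; apply: continuous_comp; last exact: push_continuous.
exact: initial_continuous.
Qed.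

End push_continuity.

Section measurable_maps.
Context {R : realType}.

Lemma continuous_refined (X : ptopologicalType) (Y : topologicalType)
    (c : X -> R) (G : X -> Y) :
  continuous G -> continuous (G : initial_topology (fun x => (x, c x)) -> Y).
Proof.
move=> cG x.
have cw : {for x, continuous
    ((fun x => (x, c x)) : initial_topology (fun x => (x, c x)) -> X * R)}.
  exact: initial_continuous.
have cx : {for x, continuous (id : initial_topology (fun x => (x, c x)) -> X)}.
  exact: continuous_comp cw (@cvg_fst _ _ _ _ _).
exact: continuous_comp cx (cG x).
Qed.

Lemma continuous_factor_refined (X : ptopologicalType) (c : X -> R) :
  continuous (c : initial_topology (fun x => (x, c x)) -> R).
Proof.
move=> x.
have cw : {for x, continuous
    ((fun x => (x, c x)) : initial_topology (fun x => (x, c x)) -> X * R)}.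
  exact: initial_continuous.
exact: continuous_comp cw (@cvg_snd _ _ _ _ _).
Qed.

Lemma measurable_toNormalized (X : ptopologicalType) (F : X -> radon R) :
  continuous F ->
  measurable_fun setT ((fun x => toNormalized (F x)) : borel X -> borel (normalized R)).
Proof.
move=> cF; apply: (refined_measurable (measurable_normalizing_factor cF)).
apply: continuous_normalize; first exact: continuous_refined.
exact: continuous_factor_refined.
Qed.

Lemma measurable_blowup s b (s0 : 0 < s) :
  measurable_fun setT (blowup b s0 : borel (normalized R) -> borel (normalized R)).
Proof.
by apply: measurable_toNormalized; exact: continuous_push_normalized.
Qed.

Lemma measurable_tstar x :
  measurable_fun setT (tstar x : borel (normalized R) -> borel (normalized R)).
Proof.
by apply: measurable_toNormalized; exact: continuous_push_normalized.
Qed.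

Lemma measurable_mass a b : measurable_fun setT
  (fun nu : borel (normalized R) => (nu : normalized R) `[a, b[%classic).
Proof. by apply: measurable_itv_mass; exact: initial_continuous. Qed.

Context (p : nat) (p_gt1 : (1 < p)%N).
Local Notation space := (CP_space R p_gt1).

Lemma continuous_ihat n :
  continuous (@ihat R p p_gt1 n : space -> discrete_topology (digit p_gt1)).
Proof.
move=> x; have c2 : {for x, continuous (fun x : space => x.2)} by exact: cvg_snd.
exact: (@continuous_comp _ _ _ (fun x : space => x.2) (fun f => f n) x c2
  (@continuous_coordinate _ (fun=> discrete_topology (digit p_gt1)) n _)).
Qed.

Lemma measurable_ihat n (A : set (digit p_gt1)) :
  measurable (@ihat R p p_gt1 n @^-1` A).
Proof.
apply: sub_sigma_algebra; move/continuousP: (@continuous_ihat n); apply.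
exact: discrete_open.
Qed.

(** Before normalization the map is continuous, since the digit that selects
    the magnification is locally constant; its shift component is continuous
    as well. *)
Lemma measurable_M_map :
  measurable_fun setT (@M_map R p p_gt1).
Proof.
pose F (x : space) : radon R :=
  push (@rho_continuous _ _ _ (ihat 1 x)) (@rho_proper _ _ _ (ihat 1 x)) x.1.
have cF : continuous F.
  move=> x A FxA.
  pose G (y : space) : radon R :=
    push (@rho_continuous _ _ _ (ihat 1 x)) (@rho_proper _ _ _ (ihat 1 x)) y.1.
  have cG : {for x, continuous G}.
    have c1 : {for x, continuous (fun y : space => y.1)} by exact: cvg_fst.
    exact: (@continuous_comp _ _ _ (fun y : space => y.1) _ x c1
      (@continuous_push_normalized _ _ (@rho_continuous _ _ _ (ihat 1 x))
        (@rho_proper _ _ _ (ihat 1 x)) x.1)).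
  have i1 : nbhs x [set y : space | ihat 1 y = ihat 1 x].
    apply: (@continuous_ihat 1 x [set ihat 1 x]).
    by apply: open_nbhs_nbhs; split => //; exact: discrete_open.
  apply: filterS2 i1 (cG A FxA) => y yx.
  by rewrite /preimage/= /F yx.
apply: (@refined_measurable R space space (fun x => normalizing_factor (F x))).
  exact: measurable_normalizing_factor.
pose W := initial_topology (fun x : space => (x, normalizing_factor (F x))).
have c1 : continuous ((fun x => toNormalized (F x)) : W -> normalized R).
  apply: continuous_normalize; first exact: continuous_refined.
  exact: continuous_factor_refined.
have c2 : continuous ((fun x n => x.2 (n + 1)) : W ->
    {ptws int -> discrete_topology (digit p_gt1)}).
  apply: (@continuous_refined space
    {ptws int -> discrete_topology (digit p_gt1)}).
  by apply: continuous_pointwise => n; exact: (@continuous_ihat (n + 1)).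
by move=> x; exact: cvg_pair (c1 x) (c2 x).
Qed.

End measurable_maps.

(** * Integration against a density *)

Section density.
Context d d' (T : measurableType d) (T' : measurableType d') (R : realType).
Variables (mu : {measure set T -> \bar R}) (X : T -> T').
Hypothesis mX : measurable_fun setT X.
Variables (E D : set T) (k : T -> \bar R).
Hypotheses (mE : measurable E) (mD : measurable D) (mk : measurable_fun setT k).
Hypotheses (k0 : forall x, (0 <= k x)%E) (kfin : forall x, k x \is a fin_num).
Hypothesis density : forall C, measurable C ->
  (mu (E `&` X @^-1` C) = \int[mu]_(x in D `&` X @^-1` C) k x)%E.

Import HBNNSimple.

Let mXC C : measurable C -> measurable (X @^-1` C).
Proof. by move=> mC; rewrite -[_ @^-1` _]setTI; exact: mX. Qed.

Let density_indic (r : R) C : 0 <= r -> measurable C ->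
  (\int[mu]_(x in E) (r * \1_C (X x))%:E =
   \int[mu]_(x in D) ((r * \1_C (X x))%:E * k x))%E.
Proof.
move=> r0 mC.
have indicX x : \1_C (X x) = \1_(X @^-1` C) x :> R by [].
under eq_integral do rewrite indicX EFinM.
rewrite ge0_integralZl//; last exact/measurable_EFinP/measurable_indic/mXC.
rewrite integral_indic//; last exact: mXC.
rewrite setIC density//.
under [RHS]eq_integral do rewrite indicX EFinM -muleA.
have mindic : measurable_fun D (fun x => (\1_(X @^-1` C) x)%:E * k x)%E.
  apply: emeasurable_funM; last exact: measurable_funTS.
  exact/measurable_EFinP/measurable_indic/mXC.
rewrite ge0_integralZl//; last by move=> x _; rewrite mule_ge0 ?lee_fin.
congr (_ * _)%E; rewrite integral_mkcondr; apply: eq_integral => x _.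
rewrite patchE indicE/=; case: ifPn => xC; first by rewrite mul1e.
by rewrite mul0e.
Qed.

Let density_nnsfun (g : {nnsfun T' >-> R}) :
  (\int[mu]_(x in E) (g (X x))%:E = \int[mu]_(x in D) ((g (X x))%:E * k x))%E.
Proof.
have mterm (A : set T) r :
    measurable_fun A (fun x => (r * \1_(g @^-1` [set r]) (X x))%:E).
  apply: measurable_funTS; apply/measurable_EFinP; apply: measurable_funM => //.
  exact: (measurable_indic (mXC (measurable_sfunP g (measurable_set1 r)))).
under eq_integral do rewrite fimfunE -fsumEFin//.
have term0 r x : (0 <= (r * \1_(g @^-1` [set r]) (X x))%:E)%E.
  exact: nnfun_muleindic_ge0.
rewrite ge0_integral_fsum//.
transitivity (\int[mu]_(x in D) (\sum_(r \in range g)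
    ((r * \1_(g @^-1` [set r]) (X x))%:E * k x))%E)%E; last first.
  apply: eq_integral => x _.
  rewrite -ge0_mule_fsuml => [|r]; last exact: term0.
  by rewrite fsumEFin// -fimfunE.
rewrite ge0_integral_fsum//; last 2 first.
- by move=> r; apply: emeasurable_funM; [exact: mterm|exact: measurable_funTS].
- by move=> r x _; rewrite mule_ge0//; exact: term0.
apply: eq_fsbigr => r /[!inE] -[y _ <-].
exact: density_indic.
Qed.

(** If on the sets defined by [X] the event [E] has density [k] inside [D], the
    same holds for functions of [X], by simple functions and monotone
    convergence. With [D] an event of the past and [E] its part where the
    next digit is [j], this turns conditional probabilities into conditional
    expectations. *)
Lemma ge0_integral_density (h : T' -> \bar R) :
  measurable_fun setT h -> (forall y, 0 <= h y)%E ->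
  (\int[mu]_(x in E) h (X x) = \int[mu]_(x in D) (h (X x) * k x))%E.
Proof.
move=> mh h0; pose g := nnsfun_approx measurableT mh.
have gh y : (g n y)%:E @[n --> \oo] --> h y by exact: cvg_nnsfun_approx.
have nd_g y : {homo (fun n => (g n y)%:E) : m n / (m <= n)%N >-> (m <= n)%E}.
  by move=> m n mn; rewrite lee_fin; exact/lefP/nd_nnsfun_approx.
transitivity (limn (fun n => \int[mu]_(x in E) (g n (X x))%:E)%E).
  rewrite -monotone_convergence//; last 2 first.
  - by move=> n; apply/measurable_EFinP; apply/measurable_funTS; exact: measurableT_comp.
  - by move=> n x _; rewrite lee_fin.
  by apply: eq_integral => x _; apply/esym/cvg_lim.
transitivity (limn (fun n => \int[mu]_(x in D) ((g n (X x))%:E * k x))%E).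
  by congr (limn _); apply/funext => n; exact: density_nnsfun.
rewrite -monotone_convergence//; last 3 first.
- move=> n; apply: emeasurable_funM; last exact: measurable_funTS.
  by apply/measurable_EFinP; apply/measurable_funTS; exact: measurableT_comp.
- by move=> n x _; rewrite mule_ge0// lee_fin.
- by move=> x _ m n mn; rewrite lee_wpmul2r//; exact: nd_g.
by apply: eq_integral => x _; apply/cvg_lim => //; apply: cvgeZr.
Qed.

End density.

(** * Cells, codes and the past *)

Section CP_dynamics.
Context {R : realType} (p : nat) (p_gt1 : (1 < p)%N).
Local Notation digit := (digit p_gt1).
Local Notation space := (borel (CP_space R p_gt1)).
Implicit Types (x : space) (j : digit).

Let p_gt0 : 0 < p%:R :> R. Proof. by rewrite ltr0n ltnW. Qed.

Let pX_gt0 n : 0 < p%:R ^+ n :> R. Proof. by rewrite exprn_gt0. Qed.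

(** The [a]-th cell of level [n] is the interval from [a / p ^ n], included, to
    [(a + 1) / p ^ n], excluded. *)
Definition magnify n (a : nat) : normalized R -> normalized R :=
  blowup a%:R (pX_gt0 n).

Definition mass n (a : nat) (nu : normalized R) : \bar R :=
  (nu : radon R) (unit_cell (p%:R ^+ n) a%:R).

Lemma mass_ge0 n a nu : (0 <= mass n a nu)%E.
Proof. exact: measure_ge0. Qed.

Lemma measurable_unit_cell (s b : R) : measurable (unit_cell s b).
Proof. by rewrite -[unit_cell s b]setTI; exact: measurable_affine. Qed.

Lemma mass_fin n a nu : mass n a nu \is a fin_num.
Proof.
by rewrite ge0_fin_numE ?mass_ge0// /mass unit_cellE//; exact: radon_itv_fin.
Qed.

Lemma measurable_mass_cell n a :
  measurable_fun setT (mass n a : borel (normalized R) -> \bar R).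
Proof.
rewrite (_ : mass n a = fun nu : normalized R => (nu : radon R)
    `[a%:R / p%:R ^+ n, (a%:R + 1) / p%:R ^+ n[%classic).
  exact: measurable_mass.
by apply/funext => nu; rewrite /mass unit_cellE.
Qed.

Lemma measurable_magnify n a : measurable_fun setT
  (magnify n a : borel (normalized R) -> borel (normalized R)).
Proof. exact: measurable_blowup. Qed.

Lemma M_map_magnify x : (M_map x).1 = magnify 1 (ihat 1 x) x.1.
Proof.
apply: (congr1 toNormalized); apply: push_eq; apply/funext => y.
by rewrite /affine /rho expr1.
Qed.

Lemma mass_digit_cell j nu : mass 1 j nu = (nu : radon R) (digit_cell j).
Proof. by rewrite /mass unit_cellE// expr1 natr1. Qed.

Lemma mass0_le1 nu : (mass 0 0 nu <= 1)%E.
Proof.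
by rewrite /mass unit_cellE// expr0 !divr1 add0r; exact: normalized_unit_le1.
Qed.

Lemma magnifyS n (a j : nat) nu :
  magnify n a (magnify 1 j nu) = magnify n.+1 (j * p ^ n + a) nu.
Proof.
apply: blowup_comp; first by rewrite -exprD addn1.
by rewrite natrD natrM natrX mulrC.
Qed.

(** Distinct cells of one level have magnifications in the same orbit of the
    integer translations. *)
Lemma tstar_magnify (k : int) n (a b : nat) nu : a%:Z + k = b%:Z ->
  tstar k%:~R (magnify n a nu) = magnify n b nu.
Proof.
move=> akb; rewrite (tstar_blowup _ ltr01).
apply: blowup_comp; first exact: mul1r.
by rewrite mul1r -[b%:R]/(b%:Z%:~R) -akb intrD.
Qed.

Lemma unit_cell_sub n (a : nat) : (a < p ^ n)%N ->
  unit_cell (p%:R ^+ n) a%:R `<=` (`[0, 1[%classic : set R).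
Proof.
move=> an y; rewrite unit_cellE//= !in_itv/= => /andP[ay ya].
apply/andP; split; first by apply: le_trans ay; rewrite divr_ge0// ltW.
apply: (lt_le_trans ya).
by rewrite ler_pdivrMr// mul1r natr1 -natrX ler_nat.
Qed.

Lemma affine_preimage_cell n (a j : nat) :
  affine (p%:R ^+ 1) j%:R @^-1` unit_cell (p%:R ^+ n) a%:R =
  unit_cell (p%:R ^+ n.+1) (j * p ^ n + a)%:R :> set R.
Proof.
have comp y : affine (p%:R ^+ n) a%:R (affine (p%:R ^+ 1) j%:R y) =
    affine (p%:R ^+ n.+1) (j * p ^ n + a)%:R y :> R.
  by rewrite /affine expr1 natrD natrM natrX exprSr; ring.
by apply/funext => y; rewrite /unit_cell /preimage/= comp.
Qed.

Lemma magnify_cond n (a j : nat) nu : (a < p ^ n)%N ->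
  (mass n a (magnify 1 j nu) * mass 1 j nu = mass n.+1 (j * p ^ n + a) nu)%E.
Proof.
move=> an; rewrite /mass /magnify blowup_cond ?affine_preimage_cell//.
- exact: measurable_unit_cell.
- exact: unit_cell_sub.
Qed.

(** The index of the cell of level [n] selected by the digits [i_1, ..., i_n],
    read in base [p] with [i_1] as the leading digit. *)
Fixpoint code n x : nat :=
  if n is m.+1 then (ihat 1 x * p ^ m + code m (M_map x))%N else 0%N.

Lemma code_bound n x : (code n x < p ^ n)%N.
Proof.
elim: n x => [|n ih] x /=; first by [].
have j := ltn_ord (ihat 1 x).
apply: (@leq_trans ((ihat 1 x).+1 * p ^ n)); last by rewrite expnS leq_mul2r j orbT.
by rewrite mulSn addnC ltn_add2r.
Qed.

Lemma iter_M_map_magnify n x : (iter n M_map x).1 = magnify n (code n x) x.1.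
Proof.
elim: n x => [|n ih] x.
  by apply/esym/blowup_id; rewrite ?expr0.
by rewrite iterSr ih M_map_magnify magnifyS.
Qed.

Lemma measurable_code n a : measurable [set x | code n x = a].
Proof.
elim: n a => [|n ih] a.
  have [<-|a0] := eqVneq 0%N a.
    by rewrite (_ : [set _ | _] = setT)//; apply/seteqP; split.
  rewrite (_ : [set _ | _] = set0)//; apply/seteqP; split => // x /= /eqP.
  by rewrite (negbTE a0).
pose F (b : digit * nat) : set space := ihat 1 @^-1` [set b.1] `&`
  (M_map @^-1` [set x | code n x = b.2] `&` [set _ | (b.1 * p ^ n + b.2)%N = a]).
rewrite (_ : [set _ | _] = \bigcup_b F b).
  apply: countable_bigcupT_measurable => [|b]; first exact: countableP.
  apply: measurableI; first exact: measurable_ihat.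
  apply: measurableI.
    by rewrite -[X in measurable X]setTI; apply: measurable_M_map.
  have [ba|ba] := pselect ((b.1 * p ^ n + b.2)%N = a).
    by rewrite (_ : [set _ | _] = setT)//; apply/seteqP; split.
  by rewrite (_ : [set _ | _] = set0)//; apply/seteqP; split.
apply/seteqP; split=> x.
  by move=> xa; exists (ihat 1 x, code n (M_map x)).
by move=> [[j b] _ [/= xj [/= xb jb]]]; rewrite /= xj xb.
Qed.

End CP_dynamics.

Section past_sigma_algebra.
Context {R : realType} (p : nat) (p_gt1 : (1 < p)%N).
Local Notation digit := (digit p_gt1).
Local Notation space := (borel (CP_space R p_gt1)).
Implicit Types (x : space) (j : digit) (G : set space).

Lemma past_nuhat (B : set (borel (normalized R))) :
  measurable B -> (past : set (set space)) (nuhat @^-1` B).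
Proof. by move=> mB; apply: sub_sigma_algebra; left; exists B. Qed.

Lemma past_ihat n j : n <= 0 -> (past : set (set space)) (ihat n @^-1` [set j]).
Proof. by move=> n0; apply: sub_sigma_algebra; right; exists n, j. Qed.

Lemma past_measurable G : past G -> measurable G.
Proof.
apply: smallest_sub; first exact: sigma_algebra_measurable.
move=> _ [[B mB ->]|[n [j [_ ->]]]]; last exact: measurable_ihat.
by rewrite -[_ @^-1` _]setTI; exact: measurable_nuhat.
Qed.

Let sigma_past : sigma_algebra setT (past : set (set space)).
Proof. exact: smallest_sigma_algebra. Qed.

Lemma past_bigcup (F : nat -> set space) :
  (forall n, past (F n)) -> past (\bigcup_n F n).
Proof. by case: sigma_past => _ _; exact. Qed.

Lemma past_setC G : past G -> past (~` G).
Proof. by case: sigma_past => _ + _ => /[apply]; rewrite setTD. Qed.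

Lemma past_set0 : past (set0 : set space).
Proof. by case: sigma_past. Qed.

Lemma past_setU G H : past G -> past H -> past (G `|` H).
Proof.
move=> pG pH; rewrite -bigcup2E; apply: past_bigcup => -[|[|n]]//=.
exact: past_set0.
Qed.

Lemma past_setI G H : past G -> past H -> past (G `&` H).
Proof.
move=> pG pH; rewrite -[G `&` H]setCK setCI.
by apply: past_setC; apply: past_setU; exact: past_setC.
Qed.

Lemma past_finite_bigcup (F : digit -> set space) :
  (forall j, past (F j)) -> past (\bigcup_j F j).
Proof.
move=> pF; rewrite (_ : \bigcup_j F j = \bigcup_n
    (if [pick j : digit | j == n :> nat] is Some j then F j else set0)).
  apply: past_bigcup => n; case: pickP => [j _|_]; first exact: pF.
  exact: past_set0.
apply/seteqP; split=> x.
  move=> [j _ Fj]; exists (j : nat) => //; case: pickP => [k /eqP kj|/(_ j)].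
    by rewrite (val_inj kj : k = j).
  by rewrite eqxx.
by move=> [n _]; case: pickP => // j _ Fj; exists j.
Qed.

(** The measure is recovered from its image and the digit that was used,
    which for the shifted point is the digit of index 0. *)
Definition demagnify (j : digit) : normalized R -> normalized R :=
  @blowup R p%:R^-1 (- (j%:R / p%:R))
    ltac:(by rewrite invr_gt0 ltr0n ltnW).

Lemma demagnifyK x : demagnify (ihat 1 x) (M_map x).1 = x.1.
Proof.
have p0 : p%:R != 0 :> R by rewrite pnatr_eq0 -lt0n ltnW.
rewrite M_map_magnify -[RHS](blowup_id ltr01 _ erefl erefl).
apply: blowup_comp; first by rewrite expr1 mulVf.
by rewrite mulrC subrr.
Qed.

(** This is where it matters that the past contains digits: the measure before
    the shift can be reconstructed from the measure after it together with the
    digit [i_1], which the shift turns into the digit of index 0. *)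
Lemma past_shift G : past G -> exists2 G', past G' & G = M_map @^-1` G'.
Proof.
suff sub : (past : set (set space)) `<=`
    [set G | exists2 G' : set space, past G' & G = M_map @^-1` G'].
  exact: sub.
apply: smallest_sub; first split.
- by exists set0; [exact: past_set0|].
- move=> _ [G' pG' ->]; exists (~` G'); first exact: past_setC.
  by rewrite setTD.
- move=> F hF.
  pose F' n := sval (cid2 (hF n)).
  have F'P n : past (F' n) /\ F n = M_map @^-1` F' n.
    by rewrite /F'; case: cid2.
  exists (\bigcup_n F' n); first by apply: past_bigcup => n; case: (F'P n).
  by rewrite preimage_bigcup; apply: eq_bigcupr => n _; case: (F'P n).
move=> _ [[B mB ->]|[n [j [n0 ->]]]].
  (* The digit used by the shift is unknown, but it is now recorded at index 0. *)
  exists (\bigcup_j (ihat 0 @^-1` [set j] `&` nuhat @^-1` (demagnify j @^-1` B))).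
    apply: past_finite_bigcup => j; apply: past_setI; first exact: past_ihat.
    apply: past_nuhat; rewrite -[_ @^-1` _]setTI.
    exact: measurable_blowup.
  apply/seteqP; split=> x.
    move=> Bx; exists (ihat 1 x) => //; split => //.
    by rewrite /preimage/= /nuhat demagnifyK.
  move=> [j _ [xj]]; have <- : ihat 1 x = j := xj.
  by rewrite /preimage/= /nuhat demagnifyK.
exists (ihat (n - 1) @^-1` [set j]).
  by apply: past_ihat; lia.
by apply/seteqP; split=> x; rewrite /preimage/= /ihat/= subrK.
Qed.

End past_sigma_algebra.

(** * The chain rule for cell masses *)

Section conditional_masses.
Context {R : realType} (p : nat) (p_gt1 : (1 < p)%N).
Local Notation digit := (digit p_gt1).
Local Notation space := (borel (CP_space R p_gt1)).
Variable Q : probability space R.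
Hypotheses (Q_adapted : adapted Q) (Q_inv : invariant_under Q M_map).
Implicit Types (x : space) (j : digit) (G : set space).

Lemma measurable_mass_nuhat n a :
  measurable_fun setT (fun x : space => mass p n a (nuhat x)).
Proof.
exact: (measurableT_comp (measurable_mass_cell p_gt1 n a)
  (@measurable_nuhat R p p_gt1)).
Qed.

Lemma adapted_mass j G : past G ->
  (Q (ihat 1 @^-1` [set j] `&` G) = \int[Q]_(x in G) mass p 1 j x.1)%E.
Proof.
move=> pG; have [g [mg ig gG] gmass] := Q_adapted j.
rewrite -gG//; apply: ae_eq_integral.
- exact: past_measurable.
- apply: measurable_funTS; move: ig => /integrableP[]//.
- by apply: measurable_funTS; exact: measurable_mass_nuhat.
- by apply: filterS gmass => x gx _; rewrite gx mass_digit_cell.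
Qed.

(** Induction on the level, splitting off the first digit [j]. By [past_shift]
    the event [G] is the preimage of an event [G1] of the past of the shifted
    point, whose past also records [j]; so the induction hypothesis applies
    after the shift and yields the integral of a conditional mass over the
    event that the first digit is [j]. The density of this event, the mass of
    the first cell, turns it into the mass of the whole cell. At level 0
    the formula would say that [0, 1) has mass 1 almost surely, which follows
    from level 1; hence the induction starts there, with adaptedness. *)
Lemma mass_chain n (a : nat) G : (a < p ^ n.+1)%N -> past G ->
  (Q (G `&` [set x | code n.+1 x = a]) = \int[Q]_(x in G) mass p n.+1 a x.1)%E.
Proof.
have p0 : (0 < p)%N by exact: ltnW.
elim: n a G => [|n ih] a G an pG.
  rewrite expn1 in an; pose j : digit := Ordinal an.
  rewrite setIC -[a]/(j : nat) -adapted_mass//; congr (Q (_ `&` _)).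
  apply/seteqP; split=> x /=; rewrite expn0 muln1 addn0; first by move=> xa; apply: ord_inj.
  by move=> ->.
have jp : (a %/ p ^ n.+1 < p)%N by rewrite ltn_divLR ?expn_gt0 ?p0// -expnS.
pose j : digit := Ordinal jp; pose b := (a %% p ^ n.+1)%N.
have ab : a = (j * p ^ n.+1 + b)%N by exact: divn_eq.
have bn : (b < p ^ n.+1)%N by rewrite ltn_mod expn_gt0 p0.
have [G1 pG1 GE] := past_shift pG.
have mM : measurable_fun setT (@M_map R p p_gt1) := @measurable_M_map R p p_gt1.
have QM A : measurable A -> Q A = Q (M_map @^-1` A) by move=> /Q_inv.
pose h (nu : normalized R) := mass p n.+1 b (magnify p_gt1 1 j nu).
have mh : measurable_fun setT (h : borel (normalized R) -> \bar R).
  exact: measurableT_comp (measurable_mass_cell p_gt1 _ _)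
    (measurable_magnify p_gt1 _ _).
have split_digit : G `&` [set x | code n.+2 x = a] =
    M_map @^-1` (ihat 0 @^-1` [set j] `&` G1 `&` [set x | code n.+1 x = b]).
  rewrite GE; apply/seteqP; split=> x.
    move=> [Gx xa].
    have xb : code n.+1 (M_map x) = b.
      by rewrite /b -xa [code n.+2 x]/= modnMDl modn_small//; exact: code_bound.
    have xj : ihat 1 x = j.
      apply: ord_inj; rewrite /= -xa [code n.+2 x]/= divnMDl ?expn_gt0 ?p0//.
      by rewrite divn_small ?addn0//; exact: (code_bound n.+1).
    by split.
  move=> [[xj Gx] xb]; split=> //=.
  have {xj} -> : ihat 1 x = j by [].
  by rewrite [X in (_ + X)%N]xb.
have pjG1 : past (ihat 0 @^-1` [set j] `&` G1).
  by apply: past_setI => //; exact: past_ihat.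
rewrite split_digit -QM; last first.
  by apply: measurableI; [exact: past_measurable|exact: measurable_code].
rewrite ih//.
rewrite (ge0_integral_image mM QM (past_measurable pjG1)
  (measurable_funTS (measurable_mass_nuhat n.+1 b))
  (fun x => mass_ge0 p n.+1 b (nuhat x))).
transitivity (\int[Q]_(x in ihat 1 @^-1` [set j] `&` G) h (nuhat x))%E.
  rewrite GE; apply: eq_integral => x /[!inE] -[xj _].
  have {xj}xj : ihat 1 x = j by [].
  by rewrite /h /nuhat M_map_magnify xj.
rewrite (@ge0_integral_density _ _ _ _ _ Q nuhat
  (@measurable_nuhat R p p_gt1) _ G
  (fun x => mass p 1 j x.1))//.
- by apply: eq_integral => x _; rewrite ab -magnify_cond.
- by apply: measurableI; [exact: measurable_ihat|exact: past_measurable].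
- exact: past_measurable.
- exact: measurable_mass_nuhat.
- by move=> x; exact: mass_fin.
- move=> C mC; rewrite -setIA; apply: adapted_mass.
  by apply: past_setI => //; exact: past_nuhat.
Qed.

End conditional_masses.

(** * Absence of atoms *)

Section measure_preserving.
Context d (T : measurableType d) (R : realType) (Q : probability T R).
Variable M : T -> T.
Hypotheses (mM : measurable_fun setT M) (Q_inv : invariant_under Q M).

Let mMI A : measurable A -> measurable (M @^-1` A).
Proof. by move=> mA; rewrite -[_ @^-1` _]setTI; exact: mM. Qed.

(** A level set [A q] is contained in its preimage and has the same measure, so
    they differ by a null set; countably many rational levels detect every
    strict increase. *)
Lemma nondecreasing_along_orbits_ae (f : T -> \bar R) :
  measurable_fun setT f -> (forall x, f x \is a fin_num) ->
  (forall x, f x <= f (M x))%E -> {ae Q, forall x, f (M x) = f x}.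
Proof.
move=> mf ffin fM.
pose A (q : rat) := [set x | ((ratr q)%:E <= f x)%E].
have mA q : measurable (A q).
  by rewrite /A -[X in measurable X]setTI; exact: emeasurable_fun_c_infty.
have Anull q : Q (M @^-1` A q `\` A q) = 0%E.
  rewrite measureD//; last 2 first.
  - exact: mMI.
  - by rewrite ltey_eq fin_num_measure//; exact: mMI.
  rewrite setIidr; last by move=> x /= qx; exact: le_trans qx (fM x).
  by rewrite [X in (X - _)%E](Q_inv (mA q)) subee// fin_num_measure.
have null : Q.-negligible (\bigcup_(q : rat) (M @^-1` A q `\` A q)).
  pose F n := if unpickle n is Some q then M @^-1` A q `\` A q else set0.
  have -> : \bigcup_(q : rat) (M @^-1` A q `\` A q) = \bigcup_n F n.
    apply/seteqP; split=> x.
      move=> [q _ Aq]; have [n nq] : exists n, unpickle n = Some q.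
        by exists (pickle q); exact: pickleK.
      by exists n; [exact: I|rewrite /F nq].
    by move=> [n _]; rewrite /F; case: unpickle => // q Aq; exists q.
  apply: negligible_bigcup => n; rewrite /F; case: unpickle => [q|].
    by apply/negligibleP; [apply: measurableD => //; exact: mMI|exact: Anull].
  exact: negligible_set0.
apply: negligibleS null => x /= /eqP fMx.
have : (f x < f (M x))%E by rewrite lt_neqAle fM eq_sym fMx.
rewrite -(fineK (ffin x)) -(fineK (ffin (M x))) lte_fin => /rat_in_itvoo[q].
rewrite in_itv/= => /andP[fxq qfMx]; exists q => //; split.
  by rewrite /A/= -(fineK (ffin (M x))) lee_fin ltW.
by rewrite /A/= -(fineK (ffin x)) lee_fin; apply/negP; rewrite -ltNge.
Qed.

Lemma invariant_iter n A : measurable A ->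
  measurable (iter n M @^-1` A) /\ Q (iter n M @^-1` A) = Q A.
Proof.
move=> mA; elim: n => [|n [mn Qn]]; first by [].
have -> : iter n.+1 M @^-1` A = M @^-1` (iter n M @^-1` A).
  by apply/seteqP; split=> x; rewrite /preimage/= -iterSr iterS.
by split; [exact: mMI|rewrite Q_inv].
Qed.

(** The increasing union of the iterated preimages of [A] is exactly invariant
    and has the measure of [A]. *)
Lemma ergodic_subinvariant A : ergodic_under Q M -> measurable A ->
  A `<=` M @^-1` A -> Q A = 0%E \/ Q A = 1%E.
Proof.
move=> erg mA AM; pose F n := iter n M @^-1` A.
have FM n : M @^-1` F n = F n.+1.
  by apply/seteqP; split=> x; rewrite /F /preimage/= -iterSr iterS.
have Fmono n m : (n <= m)%N -> F n `<=` F m.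
  elim: m => [|m ih]; first by rewrite leqn0 => /eqP ->.
  rewrite leq_eqVlt => /predU1P[->//|/ih nm].
  by move=> x /nm; exact: AM.
have mF n : measurable (F n) by exact: (invariant_iter n mA).1.
have mUF : measurable (\bigcup_n F n) by exact: bigcupT_measurable.
have QUF : Q (\bigcup_n F n) = Q A.
  have : (Q \o F) n @[n --> \oo] --> Q (\bigcup_n F n).
    by apply: nondecreasing_cvg_mu => // n m nm; exact/subsetPset/Fmono.
  have -> : Q \o F = cst (Q A).
    by apply/funext => n /=; exact: (invariant_iter n mA).2.
  by move=> h; apply: (cvg_unique _ h) => //; exact: cvg_cst.
rewrite -QUF; apply: erg => //.
apply/seteqP; split=> x.
  by move=> [n _ Fn]; exists n.+1 => //; rewrite -FM.
move=> [n _ Fn]; exists n => //.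
by have := Fmono n n.+1 (leqnSn n) x Fn; rewrite -FM.
Qed.

End measure_preserving.

Lemma measurable_fun_case d d' (T : measurableType d) (T' : measurableType d')
    (c : T -> nat) (F : nat -> T -> T') :
  (forall n, measurable [set x | c x = n]) ->
  (forall n, measurable_fun setT (F n)) ->
  measurable_fun setT (fun x => F (c x) x).
Proof.
move=> mc mF _ B mB; rewrite setTI.
rewrite (_ : _ @^-1` B = \bigcup_n ([set x | c x = n] `&` F n @^-1` B)).
  apply: bigcupT_measurable => n; apply: measurableI => //.
  by rewrite -[X in measurable X]setTI; exact: mF.
apply/seteqP; split=> x; first by move=> Bx; exists (c x).
by move=> [n _ [/= <-]].
Qed.

Section cell_masses.
Context {R : realType} (p : nat) (p_gt1 : (1 < p)%N).
Local Notation digit := (digit p_gt1).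
Local Notation space := (borel (CP_space R p_gt1)).
Implicit Types (x : space).

Definition code_mass n x : \bar R := mass p n (code n x) (nuhat x).

Lemma code_mass_ge0 n x : (0 <= code_mass n x)%E.
Proof. exact: mass_ge0. Qed.

Lemma code_mass_fin n x : code_mass n x \is a fin_num.
Proof. exact: mass_fin. Qed.

Lemma measurable_code_mass n : measurable_fun setT (code_mass n).
Proof.
apply: (@measurable_fun_case _ _ space (\bar R) (code n)
  (fun a x => mass p n a (nuhat x))) => a; first exact: measurable_code.
exact: measurable_mass_nuhat.
Qed.

Lemma code1 x : code 1 x = ihat 1 x :> nat.
Proof. by rewrite /= expn0 muln1 addn0. Qed.

Lemma code_massM n x :
  (code_mass n (M_map x) * code_mass 1 x = code_mass n.+1 x)%E.
Proof.
rewrite /code_mass code1 /nuhat M_map_magnify magnify_cond//.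
exact: code_bound.
Qed.

Lemma code_mass_anti n x : (code_mass n.+1 x <= code_mass n x)%E.
Proof.
elim: n x => [|n ih] x; last first.
  by rewrite -(code_massM n.+1 x) -(code_massM n x) lee_wpmul2r// code_mass_ge0.
rewrite /code_mass code1 /mass; apply: le_measure.
- by rewrite inE; exact: measurable_unit_cell.
- by rewrite inE; exact: measurable_unit_cell.
rewrite [code 0 x]/= expr1 => y jy.
rewrite unit_cellE ?expr0// !divr1 add0r.
apply: (@unit_cell_sub _ p p_gt1 1 (ihat 1 x)); first by rewrite expn1.
by rewrite expr1.
Qed.

Lemma code_mass_le1 n x : (code_mass n x <= 1)%E.
Proof.
elim: n => [|n ih]; first exact: mass0_le1.
exact: le_trans (code_mass_anti n x) ih.
Qed.

Lemma code_mass_mono n m x : (n <= m)%N -> (code_mass m x <= code_mass n x)%E.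
Proof.
elim: m => [|m ih]; first by rewrite leqn0 => /eqP ->.
rewrite leq_eqVlt => /predU1P[->//|/ih].
exact: le_trans (code_mass_anti m x).
Qed.

(** The limit of the masses of the cells met by the code; it is the mass of an
    atom of [nu] when these cells shrink to a point that they contain. *)
Definition atom_mass x : \bar R := einfs (code_mass ^~ x) 0.

Lemma le_atom_mass (t : \bar R) x :
  (t <= atom_mass x)%E <-> forall n, (t <= code_mass n x)%E.
Proof.
split=> [tx n|tx]; first by apply: le_trans tx _; apply: ereal_inf_lbound; exists n.
by apply: le_ereal_inf_tmp => _ [n _ <-].
Qed.

Lemma atom_mass_ge0 x : (0 <= atom_mass x)%E.
Proof. by apply/le_atom_mass => n; exact: code_mass_ge0. Qed.

Lemma atom_mass_le n x : (atom_mass x <= code_mass n x)%E.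
Proof. by have /le_atom_mass := lexx (atom_mass x); exact. Qed.

Lemma atom_mass_fin x : atom_mass x \is a fin_num.
Proof.
rewrite ge0_fin_numE ?atom_mass_ge0//.
by rewrite (le_lt_trans (atom_mass_le 0 x))// (le_lt_trans (code_mass_le1 0 x))// ltry.
Qed.

Lemma measurable_atom_mass : measurable_fun setT atom_mass.
Proof. by apply: measurable_fun_einfs => n; exact: measurable_code_mass. Qed.

Lemma atom_mass_M x : (0 < atom_mass x)%E ->
  (atom_mass x <= atom_mass (M_map x) * code_mass 1 x)%E.
Proof.
move=> ax; have c1 : (0 < code_mass 1 x)%E := lt_le_trans ax (atom_mass_le 1 x).
have c1fin := code_mass_fin 1 x.
have c1r : 0 < fine (code_mass 1 x) by rewrite fine_gt0// c1 ltey_eq c1fin.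
suff : (atom_mass x * ((fine (code_mass 1 x))^-1)%:E <= atom_mass (M_map x))%E.
  by rewrite lee_pdivrMr// fineK.
apply/le_atom_mass => n; rewrite lee_pdivrMr// fineK// code_massM.
exact: atom_mass_le.
Qed.

Lemma atom_mass_le_M x : (atom_mass x <= atom_mass (M_map x))%E.
Proof.
have := atom_mass_ge0 x; rewrite le_eqVlt => /predU1P[<-|ax].
  exact: atom_mass_ge0.
apply: (le_trans (atom_mass_M ax)).
by rewrite -[leRHS]mule1 lee_wpmul2l ?atom_mass_ge0 ?code_mass_le1.
Qed.

Variable Q : probability space R.
Hypothesis Q_ECPD : is_extended_ECPD Q.

Lemma deterministic_of_full_mass :
  {ae Q, forall x, code_mass 1 x = 1%E} -> deterministic Q.
Proof.
case: Q_ECPD => adapt _ _ mass1.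
pose g j := sval (cid2 (adapt j)).
exists g => [j|]; first by rewrite /g; case: cid2.
have gmass : {ae Q, forall w, forall j, g j w = (nuhat w : normalized R) (digit_cell j)}.
  by apply: filter_forall => j; rewrite /g; case: cid2.
apply: filterS2 gmass mass1 => x gx; rewrite /code_mass code1 mass_digit_cell => <-.
exact: gx.
Qed.

(** If the limit mass is positive and constant along orbits, then the first cell
    has mass 1, since [M_map] divides the limit mass by it. *)
Lemma atom_mass_null : ~ deterministic Q -> Q [set x | (0 < atom_mass x)%E] = 0%E.
Proof.
move=> ndet; have [adapt inv erg] := Q_ECPD.
have mpos : measurable [set x | (0 < atom_mass x)%E].
  rewrite -[X in measurable X]setTI.
  exact: emeasurable_fun_o_infty measurable_atom_mass _.
have mM := @measurable_M_map R p p_gt1.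
have [//|pos1] := ergodic_subinvariant mM inv erg mpos
  (fun x ax => lt_le_trans ax (atom_mass_le_M x)).
exfalso; apply: ndet; apply: deterministic_of_full_mass.
have inv_ae := nondecreasing_along_orbits_ae mM inv measurable_atom_mass
  atom_mass_fin atom_mass_le_M.
have pos_ae : {ae Q, forall x, (0 < atom_mass x)%E}.
  exists (~` [set x | (0 < atom_mass x)%E]); split => //.
  - exact: measurableC.
  - by rewrite probability_setC// pos1 subee.
apply: filterS2 inv_ae pos_ae => x ax ax0; apply/eqP.
rewrite eq_le code_mass_le1/= leNgt; apply/negP => c1.
have := atom_mass_M ax0; rewrite ax leNgt => /negP; apply.
rewrite -[ltRHS]mule1 lte_pmul2l//; exact: atom_mass_fin.
Qed.

Lemma code_mass_small (e : R) : ~ deterministic Q -> 0 < e ->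
  Q [set x | (e%:E <= code_mass n x)%E] @[n --> \oo] --> 0%E.
Proof.
move=> ndet e0; pose F n := [set x | (e%:E <= code_mass n x)%E].
have mF n : measurable (F n).
  rewrite /F -[X in measurable X]setTI.
  by apply: emeasurable_fun_c_infty => //; exact: measurable_code_mass.
have <- : Q (\bigcap_n F n) = 0%E.
  apply/eqP; rewrite eq_le measure_ge0 andbT -(atom_mass_null ndet).
  apply: le_measure; rewrite ?inE.
  - by apply: bigcapT_measurable.
  - rewrite -[X in measurable X]setTI.
    exact: emeasurable_fun_o_infty measurable_atom_mass _.
  move=> x Fx; apply: (@lt_le_trans _ _ e%:E) => //.
  by apply/le_atom_mass => n; exact: Fx.
apply: nonincreasing_cvg_mu => //.
- by rewrite -ge0_fin_numE// fin_num_measure//; exact: (mF 0%N).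
- exact: (bigcapT_measurable mF).
- by move=> n m nm; apply/subsetPset => x /le_trans; apply; exact: code_mass_mono.
Qed.

End cell_masses.

(** * Conservativity *)

Section conservativity.
Context {R : realType} (p : nat) (p_gt1 : (1 < p)%N).
Local Notation space := (borel (CP_space R p_gt1)).
Variable Q : probability space R.
Hypotheses (Q_ECPD : is_extended_ECPD Q) (Q_ndet : ~ deterministic Q).
Local Notation P := (distribution Q nuhat).

(** When the cell met by the code has mass less than [e], the magnification of
    that cell lies in [A] only if [nu] lies in [C a], [a] being the code. The
    sets [C a] are disjoint because [A] is wandering, and given [C a] the code
    is [a] with probability less than [e]. Summing over [a] gives at most
    [e]. *)
Lemma wandering_bound (A : set (borel (normalized R))) (e : R) n :
  measurable A -> 0 < e ->
  (forall (k : int) nu, k != 0 -> A nu -> ~ A (tstar k%:~R nu)) ->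
  (P A <= Q [set x | e%:E <= code_mass n.+1 x] + e%:E)%E.
Proof.
move=> mA e0 wander; have [adapt inv _] := Q_ECPD.
pose C a : set (borel (normalized R)) :=
  magnify p_gt1 n.+1 a @^-1` A `&` [set nu | (mass p n.+1 a nu < e%:E)%E].
have mC a : measurable (C a).
  apply: measurableI.
    by rewrite -[X in measurable X]setTI; exact: measurable_magnify.
  rewrite -[X in measurable X]setTI.
  exact: emeasurable_fun_infty_o (measurable_mass_cell p_gt1 _ _) _.
have mnC a : measurable (nuhat @^-1` C a : set space).
  by rewrite -[X in measurable X]setTI; exact: measurable_nuhat.
pose F a : set space := nuhat @^-1` C a `&` [set x | code n.+1 x = a].
have mF a : measurable (F a) by apply: measurableI => //; exact: measurable_code.
have mbig : measurable [set x : space | (e%:E <= code_mass n.+1 x)%E].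
  rewrite -[X in measurable X]setTI.
  by apply: emeasurable_fun_c_infty => //; exact: measurable_code_mass.
have mmA : measurable (nuhat @^-1` A : set space).
  by rewrite -[X in measurable X]setTI; exact: measurable_nuhat.
have [mB QB] := invariant_iter (@measurable_M_map R p p_gt1) inv n.+1 mmA.
have -> : P A = Q (iter n.+1 M_map @^-1` (nuhat @^-1` A)) by rewrite QB.
have QF a : (a < p ^ n.+1)%N -> (Q (F a) <= e%:E * P (C a))%E.
  move=> an; rewrite /F mass_chain//; last exact: past_nuhat.
  rewrite -[P (C a)]/(Q (nuhat @^-1` C a)) -integral_cst//.
  apply: ge0_le_integral => //.
  - by apply: measurable_funTS; exact: measurable_mass_nuhat.
  - by move=> x [_ /ltW].
have disjC : trivIset setT C.
  apply/trivIsetP => a b _ _ ab; rewrite -subset0 => nu [[Aa _] [Ab _]].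
  apply: (wander (b%:Z - a%:Z) (magnify p_gt1 n.+1 a nu)) => //.
    by rewrite subr_eq0 eqz_nat eq_sym.
  by rewrite (@tstar_magnify _ _ _ _ _ a b)// addrC subrK.
have cover : iter n.+1 M_map @^-1` (nuhat @^-1` A) `<=`
    [set x | (e%:E <= code_mass n.+1 x)%E] `|` \big[setU/set0]_(a < p ^ n.+1) F a.
  move=> x Ax; have [ex|xe] := leP e%:E (code_mass n.+1 x); [by left|right].
  rewrite -bigcup_mkord; exists (code n.+1 x); first exact: code_bound.
  split=> //; split=> //.
  by rewrite /preimage/= /nuhat -iter_M_map_magnify.
apply: (le_trans (le_measure Q _ _ cover)); rewrite ?inE//.
  by apply: measurableU => //; exact: bigsetU_measurable.
apply: (le_trans (measureU2 _ _ _)) => //; first exact: bigsetU_measurable.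
rewrite leeD2l//; apply: (le_trans (Boole_inequality _ _ )) => //.
apply: (@le_trans _ _ (\sum_(a < p ^ n.+1) e%:E * P (C a))%E).
  by apply: lee_sum => a _; exact: QF.
rewrite -ge0_sume_distrr => [|a _]; last exact: measure_ge0.
rewrite -[leRHS]mule1; apply: lee_wpmul2l; first by rewrite lee_fin ltW.
rewrite -(measure_bigsetU _ mC)// probability_le1//.
exact: bigsetU_measurable.
Qed.

Lemma wandering_null (A : set (borel (normalized R))) :
  measurable A ->
  (forall (k : int) nu, k != 0 -> A nu -> ~ A (tstar k%:~R nu)) -> P A = 0%E.
Proof.
move=> mA wander; apply/eqP; rewrite eq_le measure_ge0 andbT.
apply/lee_addgt0Pr => e e0; rewrite add0e.
(* Half of [e] for each of the two terms of the bound. *)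
have e20 : 0 < e / 2 by rewrite divr_gt0.
have /fine_cvgP[_ /cvgrPdist_lt/(_ _ e20)[N _ small]] := code_mass_small Q_ECPD Q_ndet e20.
have {small}/= := small N.+1 (leqnSn N).
rewrite sub0r normrN ger0_norm ?fine_ge0// => small.
apply: (le_trans (wandering_bound N mA e20 wander)).
rewrite [e in (_ <= e%:E)%E]splitr EFinD leeD2r//.
rewrite -[leLHS]fineK ?lee_fin ?ltW// fin_num_measure//.
rewrite -[X in measurable X]setTI.
by apply: emeasurable_fun_c_infty => //; exact: measurable_code_mass.
Qed.

Lemma tstar_image (k : int) (A : set (normalized R)) :
  tstar k%:~R @` A = tstar (- k%:~R) @^-1` A.
Proof.
apply/seteqP; split=> nu.
  by move=> [mu Amu <-]; rewrite /preimage/= tstarD addNr tstar0.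
by move=> Anu; exists (tstar (- k%:~R) nu) => //; rewrite tstarD addrN tstar0.
Qed.

(** If the nontrivial translates of [A] all meet it in null sets, removing them
    leaves a wandering set of the same measure. *)
Lemma conservative_tstar : conservative P (fun k : int => tstar k%:~R).
Proof.
move=> A mA PA; apply: contrapT => nrec.
have mtA (k : int) : measurable (tstar k%:~R @` A : set (borel (normalized R))).
  by rewrite tstar_image -[X in measurable X]setTI; exact: measurable_tstar.
have rec0 (k : int) : k != 0 -> P (A `&` tstar k%:~R @` A) = 0%E.
  move=> k0; apply/eqP; rewrite eq_le measure_ge0 andbT leNgt; apply/negP => h.
  by apply: nrec; exists k.
pose F (n : nat) : set (borel (normalized R)) :=
  if unpickle n is Some k then if k == 0 :> int then set0 else tstar k%:~R @` A
  else set0.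
have mF n : measurable (F n) by rewrite /F; case: unpickle => // k; case: ifP.
pose A0 := A `\` \bigcup_n F n.
have mUF : measurable (\bigcup_n F n) by exact: bigcupT_measurable.
have mA0 : measurable A0 by exact: measurableD.
have PA0 : P A0 = 0%E.
  apply: wandering_null => // k nu k0 [Anu _] [Atnu]; apply.
  have [n nk] : exists n, unpickle n = Some k by exists (pickle k); exact: pickleK.
  by exists n; [exact: I|rewrite /F nk (negbTE k0); exists nu].
have PAF : P (A `&` \bigcup_n F n) = 0%E.
  apply/negligibleP; first exact: measurableI.
  rewrite setI_bigcupr; apply: negligible_bigcup => n.
  apply/negligibleP; first exact: measurableI.
  rewrite /F; case: unpickle => [k|]; last by rewrite setI0 measure0.
  by case: ifPn => [_|/rec0//]; rewrite setI0 measure0.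
have PAE : P A = (P A0 + P (A `&` \bigcup_n F n))%E by exact: measureDI.
by have : (0 < P A)%E := PA; rewrite PAE PA0 PAF adde0 ltxx.
Qed.

End conservativity.

Theorem theorem1p11 (R : realType) (p : nat) (p_gt1 : (1 < p)%N)
  (Q : probability (borel (CP_space R p_gt1)) R) :
  is_extended_ECPD Q -> ~ deterministic Q ->
  conservative (distribution Q nuhat)
    (fun k : int => tstar (k%:~R)%R).
Proof.
exact: conservative_tstar.
Qed.
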